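(* Let $R$ be a commutative ring and let $A$ be a reflexive noetherian $R$-algebra. (1) The functors $\nu_A:\mathrm{proj}\,A\to \mathrm{inj}\,A$ and $\nu_A^{-}:\mathrm{inj}\,A\to\mathrm{proj}\,A$ are mutual quasi-inverses, where $\mathrm{proj}\,A$ and $\mathrm{inj}\,A$ have as objects all $R$-noetherian projective $A$-modules and all $R$-artinian injective $A$-modules, respectively. (2) There exists a duality $D=\mathrm{Hom}_R(-,I_R):\mathrm{mod}^{+}A^{\mathrm{op}}\to\mathrm{mod}^{-}A$, where $\mathrm{mod}^{+}A$ and $\mathrm{mod}^{-}A$ are abelian subcategories of $\mathrm{RMod}\,A$, whose objects are all $R$-noetherian $A$-modules and all $R$-artinian $A$-modules, respectively.
   Context: Algebras have an identity. $\mathrm{Mod}\,A$ is the category of left $A$-modules; right $A$-modules are identified with $\mathrm{Mod}\,A^{\mathrm{op}}$. $I_R$ denotes a minimal injective co-generator for $\mathrm{Mod}\,R$, and $D=\mathrm{Hom}_R(-,I_R)$, giving exact contravariant functors $\mathrm{Mod}\,A\to\mathrm{Mod}\,A^{\mathrm{op}}$ and $\mathrm{Mod}\,A^{\mathrm{op}}\to\mathrm{Mod}\,A$. A left or right $A$-module $M$ is $R$-noetherian (resp. $R$-artinian) if it is noetherian (resp. artinian) as an $R$-module; it is $R$-reflexive if the canonical monomorphism $\sigma_M:M\to D^2M$, $\sigma_M(x)(f)=f(x)$, is bijective. $\mathrm{RMod}\,A$ is the full subcategory of $\mathrm{Mod}\,A$ of $R$-reflexive modules. $A$ is a noetherian (resp.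 reflexive) $R$-algebra if ${}_AA$ is $R$-noetherian (resp. $R$-reflexive); $R$ itself is not assumed noetherian. $\mathrm{proj}\,A$ is the full subcategory of $\mathrm{Mod}\,A$ of finitely generated projective modules. Put $\nu_A=D\,\mathrm{Hom}_A(-,A)$ and $\nu_A^{-}=\mathrm{Hom}_{A^{\mathrm{op}}}(D(-),A)$, endofunctors of $\mathrm{Mod}\,A$, and let $\mathrm{inj}\,A=\nu_A(\mathrm{proj}\,A)$ (the full subcategory of modules isomorphic to some $\nu_A P$ with $P\in\mathrm{proj}\,A$). $\mathrm{mod}^{+}A$ is the full subcategory of $\mathrm{Mod}\,A$ of finitely generated modules, and $\mathrm{mod}^{-}A$ that of modules finitely co-generated by $\mathrm{inj}\,A$, i.e. modules embeddable in a finite direct sum of modules in $\mathrm{inj}\,A$. *)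

(* Defs.v *)
From HB Require Import structures.
From mathcomp Require Import all_boot all_algebra.
From mathcomp Require Import boolp.

Set Implicit Arguments.
Unset Strict Implicit.
Unset Printing Implicit Defensive.

Import GRing.Theory.
Local Open Scope ring_scope.

Record category := Category {
  ob :> Type;
  hom : ob -> ob -> Type;
  idm : forall X, hom X X;
  cmp : forall X Y Z, hom Y Z -> hom X Y -> hom X Z;
  cmp1m : forall X Y (f : hom X Y), cmp (idm Y) f = f;
  cmpm1 : forall X Y (f : hom X Y), cmp f (idm X) = f;
  cmpA : forall X Y Z W (h : hom Z W) (g : hom Y Z) (f : hom X Y),
    cmp h (cmp g f) = cmp (cmp h g) f
}.
Arguments hom {c} X Y.
Arguments idm {c} X.
Arguments cmp {c X Y Z} g f.

Record functor (C D : category) := Functor {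
  fob :> C -> D;
  fmap : forall X Y, hom X Y -> hom (fob X) (fob Y);
  fmap1 : forall X, fmap (idm X) = idm (fob X);
  fmapM : forall X Y Z (g : hom Y Z) (f : hom X Y),
    fmap (cmp g f) = cmp (fmap g) (fmap f)
}.

Record cofunctor (C D : category) := Cofunctor {
  cfob :> C -> D;
  cfmap : forall X Y, hom X Y -> hom (cfob Y) (cfob X);
  cfmap1 : forall X, cfmap (idm X) = idm (cfob X);
  cfmapM : forall X Y Z (g : hom Y Z) (f : hom X Y),
    cfmap (cmp g f) = cmp (cfmap f) (cfmap g)
}.

Program Definition idfunctor (C : category) : functor C C :=
  @Functor C C (fun X => X) (fun _ _ f => f) _ _.

Program Definition cmpfunctor (C D E : category)
    (G : functor D E) (F : functor C D) : functor C E :=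
  @Functor C E (fun X => G (F X)) (fun _ _ f => fmap G (fmap F f)) _ _.
Next Obligation. by rewrite !fmap1. Qed.
Next Obligation. by rewrite !fmapM. Qed.

Program Definition cmpcofunctor (C D E : category)
    (G : cofunctor D E) (F : cofunctor C D) : functor C E :=
  @Functor C E (fun X => G (F X)) (fun _ _ f => cfmap G (cfmap F f)) _ _.
Next Obligation. by rewrite !cfmap1. Qed.
Next Obligation. by rewrite !cfmapM. Qed.

Definition full (C : category) (P : C -> Prop) : category :=
  @Category {X : C | P X} (fun X Y => hom (sval X) (sval Y))
    (fun X => idm (sval X)) (fun _ _ _ g f => cmp g f)
    (fun _ _ f => cmp1m f) (fun _ _ f => cmpm1 f)
    (fun _ _ _ _ h g f => cmpA h g f).

Definition restrict (C D : category) (F : functor C D)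
    (P : C -> Prop) (Q : D -> Prop) (PQ : forall X, P X -> Q (F X)) :
    functor (full P) (full Q) :=
  @Functor (full P) (full Q) (fun X => exist Q (F (sval X)) (PQ _ (svalP X)))
    (fun _ _ f => fmap F f) (fun _ => fmap1 F _) (fun _ _ _ g f => fmapM F g f).

Definition corestrict (C D : category) (F : cofunctor C D)
    (P : C -> Prop) (Q : D -> Prop) (PQ : forall X, P X -> Q (F X)) :
    cofunctor (full P) (full Q) :=
  @Cofunctor (full P) (full Q) (fun X => exist Q (F (sval X)) (PQ _ (svalP X)))
    (fun _ _ f => cfmap F f) (fun _ => cfmap1 F _)
    (fun _ _ _ g f => cfmapM F g f).

Section CategoryNotions.
Variable C : category.
Implicit Types X Y Z K : C.

Definition is_iso X Y (f : hom X Y) :=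
  exists g : hom Y X, cmp g f = idm X /\ cmp f g = idm Y.

Definition isomorphic X Y := exists f : hom X Y, is_iso f.

Definition mono X Y (f : hom X Y) :=
  forall Z (g h : hom Z X), cmp f g = cmp f h -> g = h.

Definition epi X Y (f : hom X Y) :=
  forall Z (g h : hom Y Z), cmp g f = cmp h f -> g = h.

Definition is_zero Z :=
  (forall X, exists! f : hom X Z, True) /\ (forall X, exists! f : hom Z X, True).

Definition is_zero_mor X Y (f : hom X Y) :=
  exists Z (h : hom Z Y) (g : hom X Z), is_zero Z /\ f = cmp h g.

Definition is_product X Y P (p : hom P X) (q : hom P Y) :=
  forall Z (f : hom Z X) (g : hom Z Y),
    exists! h : hom Z P, cmp p h = f /\ cmp q h = g.

Definition is_coproduct X Y S (i : hom X S) (j : hom Y S) :=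
  forall Z (f : hom X Z) (g : hom Y Z),
    exists! h : hom S Z, cmp h i = f /\ cmp h j = g.

Definition is_kernel X Y (f : hom X Y) K (k : hom K X) :=
  is_zero_mor (cmp f k) /\
  forall Z (g : hom Z X), is_zero_mor (cmp f g) ->
    exists! h : hom Z K, cmp k h = g.

Definition is_cokernel X Y (f : hom X Y) K (c : hom Y K) :=
  is_zero_mor (cmp c f) /\
  forall Z (g : hom Y Z), is_zero_mor (cmp g f) ->
    exists! h : hom K Z, cmp h c = g.

Record abelian_category : Prop := AbelianCategory {
  abelian_zero : exists Z, is_zero Z;
  abelian_product : forall X Y, exists P (p : hom P X) (q : hom P Y),
    is_product p q;
  abelian_coproduct : forall X Y, exists S (i : hom X S) (j : hom Y S),
    is_coproduct i j;
  abelian_kernel : forall X Y (f : hom X Y), exists K (k : hom K X),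
    is_kernel f k;
  abelian_cokernel : forall X Y (f : hom X Y), exists K (c : hom Y K),
    is_cokernel f c;
  abelian_mono : forall X Y (f : hom X Y), mono f ->
    exists Z (g : hom Y Z), is_kernel g f;
  abelian_epi : forall X Y (f : hom X Y), epi f ->
    exists Z (g : hom Z X), is_cokernel g f
}.

End CategoryNotions.

Definition natural_iso (C D : category) (F G : functor C D) :=
  exists t : forall X, hom (F X) (G X),
    (forall X Y (f : hom X Y), cmp (t Y) (fmap F f) = cmp (fmap G f) (t X)) /\
    (forall X, is_iso (t X)).

Definition quasi_inverses (C D : category) (F : functor C D)
    (G : functor D C) :=
  natural_iso (cmpfunctor G F) (idfunctor C) /\
  natural_iso (cmpfunctor F G) (idfunctor D).

Definition is_duality (C D : category) (F : cofunctor C D) :=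
  exists G : cofunctor D C,
    natural_iso (cmpcofunctor G F) (idfunctor C) /\
    natural_iso (cmpcofunctor F G) (idfunctor D).

(* Between abelian categories, preserving kernels and cokernels amounts to
   being additive and preserving short exact sequences. *)
Definition exact_functor (C D : category) (F : functor C D) :=
  (forall (X Y K : C) (f : hom X Y) (k : hom K X),
     is_kernel f k -> is_kernel (fmap F f) (fmap F k)) /\
  (forall (X Y K : C) (f : hom X Y) (c : hom Y K),
     is_cokernel f c -> is_cokernel (fmap F f) (fmap F c)).

(* For full subcategories P and Q of C: P is contained in Q, is an abelian
   category in its own right, and its inclusion in Q is exact. *)
Definition abelian_subcategory (C : category) (P Q : C -> Prop) :=
  exists PQ : forall X, P X -> Q X,
    abelian_category (full P) /\
    exact_functor (restrict (F := idfunctor C) PQ).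

Section LinearMaps.
Variables (K : pzRingType) (U V : lmodType K).

Lemma linear_ext (f g : {linear U -> V}) : f =1 g -> f = g.
Proof.
case: f g => [f [[f0] [fZ]]] [g [[g0] [gZ]]] /= /funext fg.
move: g0 gZ; rewrite -fg => g0 gZ.
by rewrite (Prop_irrelevance f0 g0) (Prop_irrelevance fZ gZ).
Qed.

Definition homs : Type := {linear U -> V}.

HB.instance Definition _ := gen_eqMixin homs.
HB.instance Definition _ := gen_choiceMixin homs.

Definition homs0 : homs := \0 : {linear U -> V}.
Definition homsN (f : homs) : homs :=
  \- (f : {linear U -> V}) : {linear U -> V}.
Definition homsD (f g : homs) : homs :=
  (f : {linear U -> V}) \+ (g : {linear U -> V}) : {linear U -> V}.

Fact homsDA : associative homsD.
Proof. by move=> f g h; apply: linear_ext => x; rewrite /= addrA. Qed.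
Fact homsDC : commutative homsD.
Proof. by move=> f g; apply: linear_ext => x; rewrite /= addrC. Qed.
Fact homs0D : left_id homs0 homsD.
Proof. by move=> f; apply: linear_ext => x; rewrite /= add0r. Qed.
Fact homsND : left_inverse homs0 homsN homsD.
Proof. by move=> f; apply: linear_ext => x; rewrite /= addNr. Qed.

HB.instance Definition _ :=
  GRing.isZmodule.Build homs homsDA homsDC homs0D homsND.

End LinearMaps.

Program Definition Mod (K : pzRingType) : category :=
  @Category (lmodType K) (fun M N => {linear M -> N}) (fun M => idfun)
    (fun _ _ _ g f => g \o f) _ _ _.
Next Obligation. exact: linear_ext. Qed.
Next Obligation. exact: linear_ext. Qed.
Next Obligation. exact: linear_ext. Qed.

Section ModuleNotions.
Variable K : pzRingType.
Implicit Types M E : lmodType K.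

(* Submodules are boolean predicates; classically every subset is one. *)
Definition noetherian M := forall S : nat -> {pred M},
  (forall n, submod_closed (S n)) -> (forall n, {subset S n <= S n.+1}) ->
  exists n, forall m, (n <= m)%N -> S m =i S n.

Definition artinian M := forall S : nat -> {pred M},
  (forall n, submod_closed (S n)) -> (forall n, {subset S n.+1 <= S n}) ->
  exists n, forall m, (n <= m)%N -> S m =i S n.

Definition finitely_generated M := exists (n : nat) (e : 'I_n -> M),
  forall x, exists a : 'I_n -> K, x = \sum_(i < n) a i *: e i.

Definition projective M :=
  forall (U V : lmodType K) (p : {linear U -> V}) (f : {linear M -> V}),
    (forall y, exists x, p x = y) ->
    exists g : {linear M -> U}, forall x, p (g x) = f x.

Definition injective_module E :=
  forall (U V : lmodType K) (i : {linear U -> V}) (f : {linear U -> E}),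
    injective i -> exists g : {linear V -> E}, forall x, g (i x) = f x.

Definition cogenerator E :=
  forall (U V : lmodType K) (f g : {linear U -> V}), f <> g ->
    exists (h : {linear V -> E}) (x : U), h (f x) <> h (g x).

(* Minimality is meant up to isomorphism: E embeds into every injective
   cogenerator, i.e. E is an injective hull of the direct sum of a set of
   representatives of the simple modules. *)
Definition minimal_injective_cogenerator E :=
  [/\ injective_module E, cogenerator E &
      forall E', injective_module E' -> cogenerator E' ->
        exists j : {linear E -> E'}, injective j].

End ModuleNotions.

Section DirectSum.
Variables (K : pzRingType) (n : nat) (E : 'I_n -> lmodType K).

Definition direct_sum : Type := forall i, E i.

HB.instance Definition _ := gen_eqMixin direct_sum.
HB.instance Definition _ := gen_choiceMixin direct_sum.

Definition dsum0 : direct_sum := fun i => 0.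
Definition dsumN (x : direct_sum) : direct_sum := fun i => - x i.
Definition dsumD (x y : direct_sum) : direct_sum := fun i => x i + y i.
Definition dsumZ (a : K) (x : direct_sum) : direct_sum := fun i => a *: x i.

Fact dsumDA : associative dsumD.
Proof. by move=> x y z; apply: functional_extensionality_dep => i; apply: addrA. Qed.
Fact dsumDC : commutative dsumD.
Proof. by move=> x y; apply: functional_extensionality_dep => i; apply: addrC. Qed.
Fact dsum0D : left_id dsum0 dsumD.
Proof. by move=> x; apply: functional_extensionality_dep => i; apply: add0r. Qed.
Fact dsumND : left_inverse dsum0 dsumN dsumD.
Proof. by move=> x; apply: functional_extensionality_dep => i; apply: addNr. Qed.

HB.instance Definition _ :=
  GRing.isZmodule.Build direct_sum dsumDA dsumDC dsum0D dsumND.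

Fact dsumZA a b x : dsumZ a (dsumZ b x) = dsumZ (a * b) x.
Proof. by apply: functional_extensionality_dep => i; apply: scalerA. Qed.
Fact dsum1Z : left_id 1 dsumZ.
Proof. by move=> x; apply: functional_extensionality_dep => i; apply: scale1r. Qed.
Fact dsumZDr : right_distributive dsumZ +%R.
Proof. by move=> a x y; apply: functional_extensionality_dep => i; apply: scalerDr. Qed.
Fact dsumZDl x : {morph dsumZ^~ x : a b / a + b}.
Proof. by move=> a b; apply: functional_extensionality_dep => i; apply: scalerDl. Qed.

HB.instance Definition _ := GRing.Zmodule_isLmodule.Build K direct_sum
  dsumZA dsum1Z dsumZDr dsumZDl.

End DirectSum.

(* algType excludes the zero ring, hence this structure: an R-algebra is a ring
   A with a ring morphism from R to the centre of A. *)
Record algebra (R : comPzRingType) := Algebra {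
  alg_ring :> pzRingType;
  alg_map : {rmorphism R -> alg_ring};
  alg_central : forall r a, alg_map r * a = a * alg_map r
}.

Section Opposite.
Variables (R : comPzRingType) (A : algebra R).

Definition op_map (r : R) : A^c := alg_map A r.

Fact op_map_zmod_morphism : zmod_morphism op_map.
Proof. exact: (rmorphB (alg_map A)). Qed.
Fact op_map_monoid_morphism : monoid_morphism op_map.
Proof.
split; first exact: (rmorph1 (alg_map A)).
by move=> r s; rewrite /op_map rmorphM alg_central.
Qed.
HB.instance Definition _ :=
  GRing.isZmodMorphism.Build R A^c op_map op_map_zmod_morphism.
HB.instance Definition _ :=
  GRing.isMonoidMorphism.Build R A^c op_map op_map_monoid_morphism.

Fact op_central (r : R) (a : A^c) : op_map r * a = a * op_map r.
Proof. exact: (esym (alg_central r (a : A))). Qed.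

Definition op_algebra : algebra R := @Algebra R A^c op_map op_central.

End Opposite.

Section Restriction.
Variables (R : comPzRingType) (A : algebra R) (M : lmodType A).

Definition restr : Type := M.

HB.instance Definition _ := GRing.Zmodule.on restr.

Definition restrZ (r : R) (x : restr) : restr := alg_map A r *: (x : M).

Fact restrZA r s x : restrZ r (restrZ s x) = restrZ (r * s) x.
Proof. by rewrite /restrZ rmorphM scalerA. Qed.
Fact restr1Z : left_id 1 restrZ.
Proof. by move=> x; rewrite /restrZ rmorph1 scale1r. Qed.
Fact restrZDr : right_distributive restrZ +%R.
Proof. by move=> r x y; apply: scalerDr. Qed.
Fact restrZDl x : {morph restrZ^~ x : r s / r + s}.
Proof. by move=> r s; rewrite /restrZ rmorphD scalerDl. Qed.

HB.instance Definition _ :=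
  GRing.Zmodule_isLmodule.Build R restr restrZA restr1Z restrZDr restrZDl.

End Restriction.

Section RestrictionMap.
Variables (R : comPzRingType) (A : algebra R) (M N : lmodType A).
Variable f : {linear M -> N}.

Definition restr_map (x : restr M) : restr N := f x.

Fact restr_map_linear : linear restr_map.
Proof. by move=> r x y; apply: linearP. Qed.
HB.instance Definition _ :=
  GRing.isLinear.Build R (restr M) (restr N) *:%R restr_map restr_map_linear.

End RestrictionMap.

(* Right A-modules are the modules over A^c; as (A^c)^c is not convertible to
   A, the functors on left modules and those on right modules are separate. *)

Section DualL.
Variables (R : comPzRingType) (I : lmodType R) (A : algebra R).

(* Hom_R(M, I) for a left module M, with the right action (f a)(x) = f (a x). *)
Section Object.
Variable M : lmodType A.

Definition dualL : Type := @homs R (restr M) I.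

HB.instance Definition _ := GRing.Zmodule.on dualL.

Definition dualL_fun (a : A^c) (f : dualL) (x : restr M) : I :=
  (f : {linear restr M -> I}) ((a : A) *: (x : M)).

Fact dualL_fun_linear a f : linear (dualL_fun a f).
Proof.
move=> r x y; rewrite -[RHS](linearP (f : {linear restr M -> I})).
congr ((f : {linear restr M -> I}) _); rewrite (scalerDr (a : A)).
by congr (_ + _); rewrite [LHS]scalerA [RHS]scalerA alg_central.
Qed.
HB.instance Definition _ a f := GRing.isLinear.Build R (restr M) I *:%R
  (dualL_fun a f) (dualL_fun_linear a f).

Definition dualLZ (a : A^c) (f : dualL) : dualL :=
  dualL_fun a f : {linear restr M -> I}.

Fact dualLZA a b f : dualLZ a (dualLZ b f) = dualLZ (a * b) f.
Proof.
apply: linear_ext => x.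
by rewrite /= /dualL_fun /= /dualL_fun scalerA.
Qed.
Fact dualL1Z : left_id 1 dualLZ.
Proof. by move=> f; apply: linear_ext => x; rewrite /= /dualL_fun scale1r. Qed.
Fact dualLZDr : right_distributive dualLZ +%R.
Proof. by move=> a f g; apply: linear_ext. Qed.
Fact dualLZDl f : {morph dualLZ^~ f : a b / a + b}.
Proof.
move=> a b; apply: linear_ext => x.
rewrite /= /dualL_fun scalerDl.
exact: (linearD (f : {linear restr M -> I})).
Qed.
HB.instance Definition _ := GRing.Zmodule_isLmodule.Build A^c dualL
  dualLZA dualL1Z dualLZDr dualLZDl.

End Object.

Section Map.
Variables (M N : lmodType A) (f : {linear M -> N}).

Definition dualL_map (u : dualL N) : dualL M :=
  (u : {linear restr N -> I}) \o restr_map f.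

Fact dualL_map_linear : linear dualL_map.
Proof.
move=> a u v; apply: linear_ext => x /=.
by congr (_ + _); rewrite /dualL_fun /= /restr_map linearZ.
Qed.
HB.instance Definition _ := GRing.isLinear.Build A^c (dualL N) (dualL M)
  *:%R dualL_map dualL_map_linear.

End Map.

Program Definition DL : cofunctor (Mod A) (Mod A^c) :=
  @Cofunctor (Mod A) (Mod A^c) (fun M => dualL M : lmodType A^c)
    (fun M N f => @dualL_map M N f : {linear dualL N -> dualL M}) _ _.
Next Obligation. by apply: linear_ext => u; apply: linear_ext. Qed.
Next Obligation. by apply: linear_ext => u; apply: linear_ext. Qed.

End DualL.

Section DualR.
Variables (R : comPzRingType) (I : lmodType R) (A : algebra R).

Local Notation op_restr := (@restr R (op_algebra A)).
Local Notation op_restr_map := (@restr_map R (op_algebra A) _ _).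

(* Hom_R(M, I) for a right module M, with the left action (a f)(x) = f (x a). *)
Section Object.
Variable M : lmodType A^c.

Definition dualR : Type := @homs R (op_restr M) I.

HB.instance Definition _ := GRing.Zmodule.on dualR.

Definition dualR_fun (a : A) (f : dualR) (x : op_restr M) : I :=
  (f : {linear op_restr M -> I}) ((a : A^c) *: (x : M)).

Fact dualR_fun_linear a f : linear (dualR_fun a f).
Proof.
move=> r x y; rewrite -[RHS](linearP (f : {linear op_restr M -> I})).
congr ((f : {linear op_restr M -> I}) _); rewrite (scalerDr (a : A^c)).
by congr (_ + _); rewrite [LHS]scalerA [RHS]scalerA op_central.
Qed.
HB.instance Definition _ a f := GRing.isLinear.Build R (op_restr M) I *:%R
  (dualR_fun a f) (dualR_fun_linear a f).

Definition dualRZ (a : A) (f : dualR) : dualR :=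
  dualR_fun a f : {linear op_restr M -> I}.

Fact dualRZA a b f : dualRZ a (dualRZ b f) = dualRZ (a * b) f.
Proof.
apply: linear_ext => x.
by rewrite /= /dualR_fun /= /dualR_fun scalerA.
Qed.
Fact dualR1Z : left_id 1 dualRZ.
Proof. by move=> f; apply: linear_ext => x; rewrite /= /dualR_fun scale1r. Qed.
Fact dualRZDr : right_distributive dualRZ +%R.
Proof. by move=> a f g; apply: linear_ext. Qed.
Fact dualRZDl f : {morph dualRZ^~ f : a b / a + b}.
Proof.
move=> a b; apply: linear_ext => x.
rewrite /= /dualR_fun scalerDl.
exact: (linearD (f : {linear op_restr M -> I})).
Qed.
HB.instance Definition _ := GRing.Zmodule_isLmodule.Build A dualR
  dualRZA dualR1Z dualRZDr dualRZDl.

End Object.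

Section Map.
Variables (M N : lmodType A^c) (f : {linear M -> N}).

Definition dualR_map (u : dualR N) : dualR M :=
  (u : {linear op_restr N -> I}) \o op_restr_map f.

Fact dualR_map_linear : linear dualR_map.
Proof.
move=> a u v; apply: linear_ext => x /=.
by congr (_ + _); rewrite /dualR_fun /= /restr_map linearZ.
Qed.
HB.instance Definition _ := GRing.isLinear.Build A (dualR N) (dualR M)
  *:%R dualR_map dualR_map_linear.

End Map.

Program Definition DR : cofunctor (Mod A^c) (Mod A) :=
  @Cofunctor (Mod A^c) (Mod A) (fun M => dualR M : lmodType A)
    (fun M N f => @dualR_map M N f : {linear dualR N -> dualR M}) _ _.
Next Obligation. by apply: linear_ext => u; apply: linear_ext. Qed.
Next Obligation. by apply: linear_ext => u; apply: linear_ext. Qed.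

End DualR.

Section HomL.
Variables (R : comPzRingType) (A : algebra R).

(* Hom_A(M, A) for a left module M, with the right action (f a)(x) = f(x) a. *)
Section Object.
Variable M : lmodType A.

Definition homL : Type := @homs A M A^o.

HB.instance Definition _ := GRing.Zmodule.on homL.

Definition homL_fun (a : A^c) (f : homL) (x : M) : A^o :=
  ((f : {linear M -> A^o}) x : A) * (a : A).

Fact homL_fun_linear a f : linear (homL_fun a f).
Proof.
move=> b x y; rewrite /homL_fun linearP.
by rewrite [LHS]mulrDl -[in LHS]mulrA.
Qed.
HB.instance Definition _ a f := GRing.isLinear.Build A M A^o *:%R
  (homL_fun a f) (homL_fun_linear a f).

Definition homLZ (a : A^c) (f : homL) : homL :=
  homL_fun a f : {linear M -> A^o}.

Fact homLZA a b f : homLZ a (homLZ b f) = homLZ (a * b) f.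
Proof. by apply: linear_ext => x; rewrite /= /homL_fun /= /homL_fun -mulrA. Qed.
Fact homL1Z : left_id 1 homLZ.
Proof. by move=> f; apply: linear_ext => x; rewrite /= /homL_fun mulr1. Qed.
Fact homLZDr : right_distributive homLZ +%R.
Proof. by move=> a f g; apply: linear_ext => x; apply: mulrDl. Qed.
Fact homLZDl f : {morph homLZ^~ f : a b / a + b}.
Proof. by move=> a b; apply: linear_ext => x; apply: mulrDr. Qed.
HB.instance Definition _ := GRing.Zmodule_isLmodule.Build A^c homL
  homLZA homL1Z homLZDr homLZDl.

End Object.

Section Map.
Variables (M N : lmodType A) (f : {linear M -> N}).

Definition homL_map (u : homL N) : homL M :=
  (u : {linear N -> A^o}) \o f.

Fact homL_map_linear : linear homL_map.
Proof. by move=> a u v; apply: linear_ext. Qed.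
HB.instance Definition _ := GRing.isLinear.Build A^c (homL N) (homL M)
  *:%R homL_map homL_map_linear.

End Map.

Program Definition HomL : cofunctor (Mod A) (Mod A^c) :=
  @Cofunctor (Mod A) (Mod A^c) (fun M => homL M : lmodType A^c)
    (fun M N f => @homL_map M N f : {linear homL N -> homL M}) _ _.
Next Obligation. by apply: linear_ext => u; apply: linear_ext. Qed.
Next Obligation. by apply: linear_ext => u; apply: linear_ext. Qed.

End HomL.

Section HomR.
Variables (R : comPzRingType) (A : algebra R).

(* Hom_A(M, A) for a right module M, with the left action (a f)(x) = a f(x). *)
Section Object.
Variable M : lmodType A^c.

Definition homR : Type := @homs A^c M A^c^o.

HB.instance Definition _ := GRing.Zmodule.on homR.

Definition homR_fun (a : A) (f : homR) (x : M) : A^c^o :=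
  (a : A) * ((f : {linear M -> A^c^o}) x : A).

Fact homR_fun_linear a f : linear (homR_fun a f).
Proof.
move=> b x y; rewrite /homR_fun linearP.
by rewrite [LHS]mulrDr; congr (_ + _); exact: (@mulrA A).
Qed.
HB.instance Definition _ a f := GRing.isLinear.Build A^c M A^c^o *:%R
  (homR_fun a f) (homR_fun_linear a f).

Definition homRZ (a : A) (f : homR) : homR :=
  homR_fun a f : {linear M -> A^c^o}.

Fact homRZA a b f : homRZ a (homRZ b f) = homRZ (a * b) f.
Proof. by apply: linear_ext => x; rewrite /= /homR_fun /= /homR_fun mulrA. Qed.
Fact homR1Z : left_id 1 homRZ.
Proof. by move=> f; apply: linear_ext => x; rewrite /= /homR_fun mul1r. Qed.
Fact homRZDr : right_distributive homRZ +%R.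
Proof. by move=> a f g; apply: linear_ext => x; exact: (@mulrDr A). Qed.
Fact homRZDl f : {morph homRZ^~ f : a b / a + b}.
Proof. by move=> a b; apply: linear_ext => x; exact: (@mulrDl A). Qed.
HB.instance Definition _ := GRing.Zmodule_isLmodule.Build A homR
  homRZA homR1Z homRZDr homRZDl.

End Object.

Section Map.
Variables (M N : lmodType A^c) (f : {linear M -> N}).

Definition homR_map (u : homR N) : homR M :=
  (u : {linear N -> A^c^o}) \o f.

Fact homR_map_linear : linear homR_map.
Proof. by move=> a u v; apply: linear_ext. Qed.
HB.instance Definition _ := GRing.isLinear.Build A (homR N) (homR M)
  *:%R homR_map homR_map_linear.

End Map.

Program Definition HomR : cofunctor (Mod A^c) (Mod A) :=
  @Cofunctor (Mod A^c) (Mod A) (fun M => homR M : lmodType A)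
    (fun M N f => @homR_map M N f : {linear homR N -> homR M}) _ _.
Next Obligation. by apply: linear_ext => u; apply: linear_ext. Qed.
Next Obligation. by apply: linear_ext => u; apply: linear_ext. Qed.

End HomR.

Section Reflexivity.
Variables (R : comPzRingType) (I : lmodType R) (A : algebra R).

Section Sigma.
Variable M : lmodType A.

Definition sigma_fun (x : M) (f : @restr R (op_algebra A) (DL I A M)) : I :=
  (f : {linear restr M -> I}) x.

Fact sigma_fun_linear x : linear (sigma_fun x).
Proof.
move=> r f g; congr (_ + _).
exact: (linearZ_LR (f : {linear restr M -> I}) r (x : restr M)).
Qed.
HB.instance Definition _ x :=
  GRing.isLinear.Build R (@restr R (op_algebra A) (DL I A M)) I *:%R
    (sigma_fun x) (sigma_fun_linear x).

Definition sigma (x : M) : DR I A (DL I A M) :=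
  sigma_fun x : {linear @restr R (op_algebra A) (DL I A M) -> I}.

Fact sigma_linear : linear sigma.
Proof.
move=> a x y; apply: linear_ext => f.
exact: (linearD (f : {linear restr M -> I}) (a *: x : restr M) (y : restr M)).
Qed.
HB.instance Definition _ :=
  GRing.isLinear.Build A M (DR I A (DL I A M)) *:%R sigma sigma_linear.

End Sigma.

Definition reflexive_module (M : lmodType A) := bijective (@sigma M).

End Reflexivity.

Section Theory.
Variables (R : comPzRingType) (I : lmodType R) (A : algebra R).
Implicit Types M : lmodType A.

Definition R_noetherian M := noetherian (restr M).
Definition R_artinian M := artinian (restr M).

Definition noetherian_algebra := R_noetherian A^o.
Definition reflexive_algebra := reflexive_module I A^o.

Definition nu : functor (Mod A) (Mod A) := cmpcofunctor (DR I A) (HomL A).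
Definition nu_minus : functor (Mod A) (Mod A) := cmpcofunctor (HomR A) (DL I A).

Definition proj M := finitely_generated M /\ projective M.

Definition inj M := exists P : Mod A, proj P /\ isomorphic (M : Mod A) (nu P).

Definition mod_plus M := finitely_generated M.

Definition mod_minus M := exists (n : nat) (E : 'I_n -> lmodType A),
  (forall i, inj (E i)) /\
  exists j : {linear M -> direct_sum E}, injective j.

End Theory.

(* Main.v *)
(* Over R, let T be reflexivity, the noetherian or the artinian condition: T passes
   to submodules, quotients and finite products (for reflexivity this is
   injectivity of I plus separation of points from submodules by maps to I).
   Hence every finitely generated left or right A-module is R-noetherian and
   R-reflexive, and the dual of such a module is R-artinian and reflexive,
   submodules of the dual corresponding to their annihilators.

   The dual of "finitely generated" is "finitely cogenerated": finitely many
   R-linear maps M -> I detect every nonzero x through the multiples a x. An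
   R-artinian module is finitely cogenerated, by descent on the common kernels;
   finitely many detecting maps embed M in D(A^n), which makes M reflexive and
   D M generated by them. This gives the duality. A retraction of M -> D(A^n)
   turns the detecting maps into a dual basis of D M when M is injective, so that
   injective R-artinian modules are the D Q with Q finitely generated projective,
   and nu and nu^- reduce to the two dualities between finitely generated
   projective left modules, right modules and these injectives. *)
Require Import Defs.
From HB Require Import structures.
From mathcomp Require Import all_boot all_algebra.
From mathcomp Require Import boolp.

Set Implicit Arguments.
Unset Strict Implicit.
Unset Printing Implicit Defensive.

Import GRing.Theory.
Local Open Scope ring_scope.

(** * Submodules and quotient modules *)

Section LinearMapConstructions.
Variable K : pzRingType.
Implicit Types U V W : lmodType K.

Definition mk_linear U V (f : U -> V) (f_lin : linear f) : {linear U -> V} :=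
  HB.pack f (GRing.isLinear.Build K U V *:%R f f_lin).

Lemma mk_linearE U V (f : U -> V) (f_lin : linear f) x :
  mk_linear f_lin x = f x.
Proof. by []. Qed.

Lemma linear_inj U V (f : {linear U -> V}) :
  (forall x, f x = 0 -> x = 0) -> injective f.
Proof.
move=> f0 x y fxy; apply/eqP; rewrite -subr_eq0; apply/eqP/f0.
by rewrite linearB fxy subrr.
Qed.

(** Choice selects a preimage of every [g z]; injectivity of [k] forces the selection to be
    linear. *)
Lemma lift_through_inj U V W (k : {linear U -> V}) (g : {linear W -> V}) :
  injective k -> (forall z, exists x, k x = g z) ->
  exists h : {linear W -> U}, forall z, k (h z) = g z.
Proof.
move=> k_inj gk.
have [h hE] := choice gk.
suff h_lin : linear h by exists (mk_linear h_lin) => z; rewrite mk_linearE hE.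
by move=> a x y; apply: k_inj; rewrite linearP !hE linearP.
Qed.

(** A chosen section of [c] need not be linear, but two preimages of a point differ by an element of
    the kernel of [c], which [g] kills. *)
Lemma factor_through_surj U V W (c : {linear U -> V}) (g : {linear U -> W}) :
  (forall y, exists x, c x = y) -> (forall x, c x = 0 -> g x = 0) ->
  exists h : {linear V -> W}, forall x, h (c x) = g x.
Proof.
move=> c_surj cg.
have [s sE] := choice c_surj.
have gs x y : c x = c y -> g x = g y.
  move=> cxy; apply/eqP; rewrite -subr_eq0 -linearB; apply/eqP/cg.
  by rewrite linearB cxy subrr.
suff h_lin : linear (fun y => g (s y)).
  by exists (mk_linear h_lin) => x; rewrite mk_linearE; apply: gs; rewrite sE.
by move=> a x y; rewrite -linearP; apply: gs; rewrite linearP !sE.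
Qed.

Lemma linear_inverse U V (f : {linear U -> V}) :
  injective f -> (forall y, exists x, f x = y) ->
  exists g : {linear V -> U}, cancel f g /\ cancel g f.
Proof.
move=> f_inj f_surj.
have [|g fg] := @lift_through_inj _ _ _ f idfun f_inj; first exact: f_surj.
by exists g; split=> [x|y]; [apply: f_inj; rewrite fg | rewrite fg].
Qed.

End LinearMapConstructions.

Section Submodule.
Variables (K : pzRingType) (M : lmodType K) (S : submodClosed M).

Record submodule := Submodule { submodule_val : M; _ : submodule_val \in S }.
HB.instance Definition _ := [isSub for submodule_val].
HB.instance Definition _ := [Choice of submodule by <:].
HB.instance Definition _ := [SubChoice_isSubLmodule of submodule by <:].

End Submodule.

Section QuotientModule.
Variables (K : pzRingType) (M : lmodType K) (P : {pred M}).
Hypothesis P_closed : submod_closed P.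
Local Open Scope quotient_scope.

Definition submod_zmodClosed : zmodClosed M := HB.pack (P : M -> bool)
  (GRing.isZmodClosed.Build M P (GRing.submod_closedB P_closed)).
Local Notation S := submod_zmodClosed.

Definition quotient_module : Type := Quotient.quot S.
HB.instance Definition _ := GRing.Zmodule.on quotient_module.

Definition to_quotient (x : M) : quotient_module := \pi_(Quotient.quot S) x.

Lemma to_quotientB x y : to_quotient (x - y) = to_quotient x - to_quotient y.
Proof. exact: (raddfB \pi_(Quotient.quot S)). Qed.

Lemma to_quotient_eq0 x : (to_quotient x = 0) <-> (x \in S).
Proof.
have -> : (x \in S) = (to_quotient x == to_quotient 0).
  by rewrite -[X in X \in _]subr0 Quotient.idealrBE.
have -> : to_quotient 0 = 0 by rewrite -(subrr 0) to_quotientB subrr.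
by split=> [->|/eqP].
Qed.

Lemma to_quotient_surj y : exists x, to_quotient x = y.
Proof. by exists (repr (y : Quotient.quot S)); apply: reprK. Qed.

Definition quotient_scale (a : K) (y : quotient_module) : quotient_module :=
  to_quotient (a *: repr (y : Quotient.quot S)).

(** The chosen representative of the class of [x] differs from [x] by an element of [S], and [S] is
    stable under scaling. *)
Lemma quotient_scaleE a x :
  quotient_scale a (to_quotient x) = to_quotient (a *: x).
Proof.
apply/eqP; rewrite -subr_eq0 -to_quotientB; apply/eqP/to_quotient_eq0.
rewrite -scalerBr -[X in X \in _]addr0.
have [S0 S_lin] := P_closed; apply: S_lin => //; apply/to_quotient_eq0.
by rewrite to_quotientB [X in X - _]reprK subrr.
Qed.

Lemma to_quotientD x y : to_quotient (x + y) = to_quotient x + to_quotient y.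
Proof. exact: (raddfD \pi_(Quotient.quot S)). Qed.

Fact quotient_scaleA a b y :
  quotient_scale a (quotient_scale b y) = quotient_scale (a * b) y.
Proof. by case: (to_quotient_surj y) => x <-; rewrite !quotient_scaleE scalerA. Qed.
Fact quotient_scale1 : left_id 1 quotient_scale.
Proof.
by move=> y; case: (to_quotient_surj y) => x <-; rewrite quotient_scaleE scale1r.
Qed.
Fact quotient_scaleDr : right_distributive quotient_scale +%R.
Proof.
move=> a y z; case: (to_quotient_surj y) (to_quotient_surj z) => x <- [t <-].
by rewrite -to_quotientD !quotient_scaleE scalerDr to_quotientD.
Qed.
Fact quotient_scaleDl y : {morph quotient_scale^~ y : a b / a + b}.
Proof.
move=> a b; case: (to_quotient_surj y) => x <-.
by rewrite !quotient_scaleE scalerDl to_quotientD.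
Qed.
HB.instance Definition _ := GRing.Zmodule_isLmodule.Build K quotient_module
  quotient_scaleA quotient_scale1 quotient_scaleDr quotient_scaleDl.

Fact to_quotient_linear : linear to_quotient.
Proof.
move=> a x y; rewrite to_quotientD; congr (_ + _).
exact/esym/quotient_scaleE.
Qed.

End QuotientModule.

Section SubmodulesAndQuotients.
Variables (K : pzRingType) (M : lmodType K).

Lemma submodule_exists (S : {pred M}) : submod_closed S ->
  exists (U : lmodType K) (i : {linear U -> M}),
    injective i /\ forall y, (y \in S) <-> exists x, i x = y.
Proof.
move=> S_closed.
pose C : submodClosed M := HB.pack (S : M -> bool)
  (GRing.isSubmodClosed.Build K M S (GRing.submod_closed_semi S_closed)).
exists (submodule C), (val : {linear submodule C -> M}).
split=> [|y]; first exact: val_inj.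
split=> [yS|[x <-]]; last exact: valP.
by exists (Submodule (yS : y \in C)).
Qed.

Lemma quotient_exists (S : {pred M}) : submod_closed S ->
  exists (V : lmodType K) (p : {linear M -> V}),
    (forall y, exists x, p x = y) /\ forall x, (p x = 0) <-> (x \in S).
Proof.
move=> S_closed.
exists (quotient_module S_closed), (mk_linear (@to_quotient_linear _ _ _ S_closed)).
by split; [exact: to_quotient_surj | exact: to_quotient_eq0].
Qed.

Lemma kernel_exists (N : lmodType K) (f : {linear M -> N}) :
  exists (U : lmodType K) (i : {linear U -> M}),
    injective i /\ forall y, (f y = 0) <-> exists x, i x = y.
Proof.
have [|U [i [i_inj iE]]] := @submodule_exists [pred x | f x == 0].
  split=> [|a x y]; rewrite !inE ?linear0 // linearP => /eqP-> /eqP->.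
  by rewrite scaler0 addr0.
exists U, i; split=> // y; rewrite -iE inE.
by split=> [->|/eqP].
Qed.

Lemma cokernel_exists (N : lmodType K) (f : {linear N -> M}) :
  exists (V : lmodType K) (p : {linear M -> V}),
    (forall y, exists x, p x = y) /\
    forall x, (p x = 0) <-> exists z, f z = x.
Proof.
have [|V [p [p_surj pE]]] := @quotient_exists [pred x | `[< exists z, f z = x >]].
  split=> [|a x y]; rewrite !inE; first by apply/asboolP; exists 0; rewrite linear0.
  move=> /asboolP[s <-] /asboolP[t <-]; apply/asboolP.
  by exists (a *: s + t); rewrite linearP.
exists V, p; split=> // y; rewrite pE inE.
by split=> /asboolP.
Qed.

End SubmodulesAndQuotients.

(** * Abelian categories of modules *)

(** In contrast with a Serre subcategory, extensions are replaced by binary products: this suffices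
    for kernels, cokernels and biproducts to be those of [Mod K]. *)
Record serre (K : pzRingType) (P : lmodType K -> Prop) : Prop := Serre {
  serre_sub : forall (U V : lmodType K) (i : {linear U -> V}),
    injective i -> P V -> P U;
  serre_quotient : forall (U V : lmodType K) (p : {linear U -> V}),
    (forall y, exists x, p x = y) -> P U -> P V;
  serre_prod : forall U V : lmodType K, P U -> P V -> P (U * V)%type
}.

Section FullSubcategory.
Variables (K : pzRingType) (P : lmodType K -> Prop).
Hypotheses (P_inhabited : exists M, P M) (P_serre : serre P).

Local Notation C := (full (C := Mod K) P).
Local Notation hom := Defs.hom.
Implicit Types X Y Z : C.

(** This and the next two definitions are casts between the full subcategory and modules with linear
    maps; they compute to projections, identities and pairs. *)
Definition carrier X : lmodType K := sval X.
Definition umap X Y (f : hom X Y) : {linear carrier X -> carrier Y} := f.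
Definition in_full (U : lmodType K) (PU : P U) : C := exist _ U PU.

Lemma hom_ext X Y (f g : hom X Y) : umap f =1 umap g -> f = g.
Proof. exact: linear_ext. Qed.

Lemma hom_eq X Y (f g : hom X Y) : f = g -> umap f =1 umap g.
Proof. by move->. Qed.

Lemma full_zero : exists Z, is_zero Z /\ forall z : carrier Z, z = 0.
Proof.
have [M PM] := P_inhabited.
have [U [i [i_inj iE]]] := kernel_exists (idfun : {linear M -> M}).
have PU := serre_sub P_serre i_inj PM.
have U0 (z : U) : z = 0.
  by apply: i_inj; rewrite linear0; apply/iE; exists z.
exists (in_full PU); split=> //; split=> X.
  exists (\0 : {linear carrier X -> U}); split=> // f _.
  by apply: hom_ext => x; rewrite [RHS]U0.
exists (\0 : {linear U -> carrier X}); split=> // f _.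
by apply: hom_ext => x; rewrite [x]U0 !linear0.
Qed.

Lemma is_zero_morE X Y (f : hom X Y) :
  is_zero_mor f <-> forall x : carrier X, umap f x = 0.
Proof.
split=> [[Z [h [g [[Z_term _] ->]]]] x|f0].
  (* On a zero object the identity equals the zero map, so whatever factors through it vanishes. *)
  have [e [_ e_uniq]] := Z_term Z.
  have /hom_eq/(_ (umap g x)) : idm Z = (\0 : {linear carrier Z -> carrier Z}).
    by rewrite -(e_uniq (idm Z) I); apply: e_uniq.
  by move=> /= gx; change (umap h (umap g x) = 0); rewrite gx linear0.
have [Z [Z_zero Z0]] := full_zero.
exists Z, (\0 : {linear carrier Z -> carrier Y}), (\0 : {linear carrier X -> carrier Z}).
by split=> //; apply: hom_ext => x; rewrite [LHS]f0.
Qed.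

Lemma sub_full (U : lmodType K) Y (i : {linear U -> carrier Y}) : injective i -> P U.
Proof. by move=> i_inj; apply: serre_sub i_inj (svalP Y). Qed.

Lemma quotient_full X (V : lmodType K) (p : {linear carrier X -> V}) :
  (forall y, exists x, p x = y) -> P V.
Proof. by move=> p_surj; apply: serre_quotient p_surj (svalP X). Qed.

Lemma exact_is_kernel X Y Z (f : hom X Y) (k : hom Z X) :
  injective (umap k) ->
  (forall x : carrier X, (umap f x = 0) <-> exists z, umap k z = x) -> is_kernel f k.
Proof.
move=> k_inj fk; split.
  by apply/is_zero_morE => z; apply/fk; exists z.
move=> W g /is_zero_morE fg.
have [z|h hE] := @lift_through_inj _ _ _ _ _ (umap g) k_inj.
  exact/fk/fg.
exists h; split=> [|h' h'E]; first by apply: hom_ext => z; exact: hE.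
by apply: hom_ext => z; apply: k_inj; rewrite [LHS]hE -(hom_eq h'E z).
Qed.

Lemma exact_is_cokernel X Y Z (f : hom X Y) (c : hom Y Z) :
  (forall z, exists y, umap c y = z) ->
  (forall y : carrier Y, (umap c y = 0) <-> exists x, umap f x = y) -> is_cokernel f c.
Proof.
move=> c_surj fc; split.
  by apply/is_zero_morE => x; apply/fc; exists x.
move=> W g /is_zero_morE gf.
have [y /fc[x <-]|h hE] := @factor_through_surj _ _ _ _ (umap c) (umap g) c_surj.
  exact: gf.
exists h; split=> [|h' h'E]; first by apply: hom_ext => z; exact: hE.
apply: hom_ext => z; have [y <-] := c_surj z.
by rewrite [LHS]hE -(hom_eq h'E y).
Qed.

(** The inclusion of the module kernel is a legitimate test morphism, since [P] is closed under
    submodules; it has to agree with the zero map. *)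
Lemma mono_injective X Y (f : hom X Y) : mono f -> injective (umap f).
Proof.
move=> f_mono; apply: linear_inj => x fx.
have [U [i [i_inj iE]]] := kernel_exists (umap f).
have [z <-] : exists z, i z = x by apply/iE.
have /hom_eq/(_ z) // : (i : hom (in_full (sub_full i_inj)) X) =
  (\0 : {linear U -> carrier X}).
apply: f_mono; apply: hom_ext => t.
by rewrite [RHS]linear0; apply/iE; exists t.
Qed.

Lemma epi_surjective X Y (f : hom X Y) :
  epi f -> forall y, exists x, umap f x = y.
Proof.
move=> f_epi y.
have [V [p [p_surj pE]]] := cokernel_exists (umap f); apply/pE.
have /hom_eq/(_ y) // : (p : hom Y (in_full (quotient_full p_surj))) =
  (\0 : {linear carrier Y -> V}).
by apply: f_epi; apply: hom_ext => x; apply/pE; exists x.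
Qed.

Lemma kernel_mono X Y Z (f : hom X Y) (k : hom Z X) : is_kernel f k -> mono k.
Proof.
move=> [fk0 k_univ] W g h kgh.
have [|u [_ u_uniq]] := k_univ W (cmp k g).
  apply/is_zero_morE => w; move/is_zero_morE: fk0; exact.
by rewrite -(u_uniq g erefl) -(u_uniq h (esym kgh)).
Qed.

Lemma cokernel_epi X Y Z (f : hom X Y) (c : hom Y Z) : is_cokernel f c -> epi c.
Proof.
move=> [cf0 c_univ] W g h gch.
have [|u [_ u_uniq]] := c_univ W (cmp g c).
  apply/is_zero_morE => x; move/is_zero_morE: cf0 => /(_ x) cfx.
  by change (umap g (umap c (umap f x)) = 0); rewrite [X in umap g X]cfx linear0.
by rewrite -(u_uniq g erefl) -(u_uniq h (esym gch)).
Qed.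

(** The module kernel of [f] belongs to the subcategory, so its inclusion factors through [k], and
    [k] reaches all of it. *)
Lemma is_kernel_exact X Y Z (f : hom X Y) (k : hom Z X) : is_kernel f k ->
  injective (umap k) /\
  forall x : carrier X, (umap f x = 0) <-> exists z, umap k z = x.
Proof.
move=> k_ker; split; first exact/mono_injective/kernel_mono/k_ker.
have [/is_zero_morE fk0 k_univ] := k_ker.
move=> x; split=> [fx|[z <-]]; last exact: fk0.
have [U [i [i_inj iE]]] := kernel_exists (umap f).
have [z <-] : exists z, i z = x by apply/iE.
have [|h [/hom_eq hE _]] :=
  k_univ (in_full (sub_full i_inj)) (i : {linear U -> carrier X}).
  by apply/is_zero_morE => t; apply/iE; exists t.
by exists (umap h z); apply: hE.
Qed.

Lemma is_cokernel_exact X Y Z (f : hom X Y) (c : hom Y Z) : is_cokernel f c ->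
  (forall z, exists y, umap c y = z) /\
  forall y : carrier Y, (umap c y = 0) <-> exists x, umap f x = y.
Proof.
move=> c_coker; split; first exact/epi_surjective/cokernel_epi/c_coker.
have [/is_zero_morE cf0 c_univ] := c_coker.
move=> y; split=> [cy|[x <-]]; last exact: cf0.
have [V [p [p_surj pE]]] := cokernel_exists (umap f); apply/pE.
have [|h [/hom_eq hE _]] :=
  c_univ (in_full (quotient_full p_surj)) (p : {linear carrier Y -> V}).
  by apply/is_zero_morE => x; apply/pE; exists x.
have <- := hE y.
by change (umap h (umap c y) = 0); rewrite cy linear0.
Qed.

Lemma pair_linear (W U V : lmodType K) (f : {linear W -> U}) (g : {linear W -> V}) :
  linear (fun w => (f w, g w) : (U * V)%type).
Proof. by move=> a x y; rewrite !linearP. Qed.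

Lemma copair_linear (W U V : lmodType K) (f : {linear U -> W}) (g : {linear V -> W}) :
  linear (fun u : (U * V)%type => f u.1 + g u.2).
Proof. by move=> a x y; rewrite !linearP scalerDr addrACA. Qed.

Definition product X Y : C :=
  in_full (serre_prod P_serre (svalP X) (svalP Y)).

(** Every construction is made in [Mod K] and stays in [P]. A mono is the kernel of its cokernel
    projection, an epi the cokernel of its kernel inclusion. *)
Lemma serre_abelian : abelian_category C.
Proof.
split.
- by have [Z [Z_zero _]] := full_zero; exists Z.
- move=> X Y; exists (product X Y).
  exists (fst : {linear (carrier X * carrier Y)%type -> carrier X}).
  exists (snd : {linear (carrier X * carrier Y)%type -> carrier Y}).
  move=> Z f g; exists (mk_linear (pair_linear (umap f) (umap g))).
  split=> [|h [/hom_eq hf /hom_eq hg]]; first by split; apply: hom_ext.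
  apply: hom_ext => z.
  by rewrite [RHS]surjective_pairing; congr (_, _); rewrite -?[LHS]hf -?[LHS]hg.
- move=> X Y; exists (product X Y).
  exists (mk_linear (pair_linear (idfun : {linear carrier X -> carrier X})
    (\0 : {linear carrier X -> carrier Y}))).
  exists (mk_linear (pair_linear (\0 : {linear carrier Y -> carrier X})
    (idfun : {linear carrier Y -> carrier Y}))).
  move=> Z f g; exists (mk_linear (copair_linear (umap f) (umap g))).
  split=> [|h [/hom_eq hf /hom_eq hg]].
    split; apply: hom_ext => x.
      by rewrite [LHS]/= /mk_linear /= linear0 addr0.
    by rewrite [LHS]/= /mk_linear /= linear0 add0r.
  apply: hom_ext => -[x y]; rewrite [LHS]/= -[umap f x]hf -[umap g y]hg.
  rewrite -[LHS](linearD (umap h)); congr (umap h _).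
  by congr (_, _); rewrite /= ?addr0 ?add0r.
- move=> X Y f; have [U [i [i_inj iE]]] := kernel_exists (umap f).
  exists (in_full (sub_full i_inj)), i; exact: exact_is_kernel.
- move=> X Y f; have [V [p [p_surj pE]]] := cokernel_exists (umap f).
  exists (in_full (quotient_full p_surj)), p; exact: exact_is_cokernel.
- move=> X Y f /mono_injective f_inj.
  have [V [p [p_surj pE]]] := cokernel_exists (umap f).
  exists (in_full (quotient_full p_surj)), p; exact: exact_is_kernel.
- move=> X Y f /epi_surjective f_surj.
  have [U [i [i_inj iE]]] := kernel_exists (umap f).
  exists (in_full (sub_full i_inj)), i; exact: exact_is_cokernel.
Qed.

End FullSubcategory.

(** In both subcategories, being a kernel or cokernel amounts to the same elementwise exactness, in
    which the subcategory no longer occurs. *)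
Lemma serre_abelian_subcategory (K : pzRingType) (P Q : Mod K -> Prop) :
  (exists M, P M) -> serre P -> serre Q -> (forall X, P X -> Q X) ->
  abelian_subcategory (C := Mod K) P Q.
Proof.
move=> P_inhabited P_serre Q_serre PQ.
have Q_inhabited : exists M, Q M by case: P_inhabited => M /PQ; exists M.
exists PQ; split; first exact: serre_abelian.
split=> X Y Z f g.
  move=> /(is_kernel_exact P_inhabited P_serre)[g_inj fg].
  exact: exact_is_kernel.
move=> /(is_cokernel_exact P_inhabited P_serre)[g_surj fg].
exact: exact_is_cokernel.
Qed.

(** * Chain conditions *)

Section ChainConditions.
Variable R : pzRingType.
Implicit Types U V : lmodType R.

Lemma preim_submod_closed U V (f : {linear U -> V}) (S : {pred V}) :
  submod_closed S -> submod_closed [pred x | f x \in S].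
Proof.
move=> [S0 S_lin]; split=> [|a x y]; rewrite !inE ?linear0 // linearP.
exact: S_lin.
Qed.

Lemma image_submod_closed U V (f : {linear U -> V}) (S : {pred U}) :
  submod_closed S ->
  submod_closed [pred y | `[< exists2 x, x \in S & f x = y >]].
Proof.
move=> [S0 S_lin]; split=> [|a x y]; rewrite !inE.
  by apply/asboolP; exists 0; rewrite ?linear0.
move=> /asboolP[s sS <-] /asboolP[t tS <-]; apply/asboolP.
by exists (a *: s + t); rewrite ?linearP //; apply: S_lin.
Qed.

(* The modular law: nested submodules of U * V with the same trace on U and the
   same projection to V coincide. *)
Lemma prod_submod_eq U V (S T : {pred (U * V)%type}) :
  submod_closed S -> submod_closed T -> {subset S <= T} ->
  (forall x, (x, 0) \in T -> (x, 0) \in S) ->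
  (forall x y, (x, y) \in T -> exists x', (x', y) \in S) -> T =i S.
Proof.
move=> [S0 S_lin] [T0 T_lin] ST trace proj [x y]; apply/idP/idP; last exact: ST.
move=> xyT; have [x' x'yS] := proj _ _ xyT.
have /trace dS : (x - x', 0) \in T.
  have -> : (x - x', 0) = -1 *: (x', y) + (x, y) :> (U * V)%type.
    by rewrite scaleN1r [RHS]surjective_pairing /= addNr addrC.
  by apply: T_lin => //; apply: ST.
have -> : (x, y) = 1 *: (x - x', 0) + (x', y) :> (U * V)%type.
  by rewrite scale1r [RHS]surjective_pairing /= add0r subrK.
exact: S_lin.
Qed.

(** The flag [asc] treats ascending and descending chains at once: [chain_condition] unfolds to
    [noetherian] at [true] and to [artinian] at [false]. *)
Definition nested U (asc : bool) (S T : {pred U}) :=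
  if asc then {subset S <= T} else {subset T <= S}.

Definition chain_condition asc U := forall S : nat -> {pred U},
  (forall n, submod_closed (S n)) -> (forall n, nested asc (S n) (S n.+1)) ->
  exists n, forall m, (n <= m)%N -> S m =i S n.

Lemma nested_preim U V asc (f : U -> V) (S T : {pred V}) :
  nested asc S T -> nested asc [pred x | f x \in S] [pred x | f x \in T].
Proof. by case: asc => ST x; apply: ST. Qed.

Lemma nested_image U V asc (f : U -> V) (S T : {pred U}) : nested asc S T ->
  nested asc [pred y | `[< exists2 x, x \in S & f x = y >]]
             [pred y | `[< exists2 x, x \in T & f x = y >]].
Proof.
case: asc => ST y; rewrite !inE => /asboolP[x xS <-]; apply/asboolP;
  by exists x => //; apply: ST.
Qed.

Lemma nested_le U asc (S : nat -> {pred U}) :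
  (forall n, nested asc (S n) (S n.+1)) ->
  forall n m, (n <= m)%N -> nested asc (S n) (S m).
Proof.
move=> S_chain n m /subnKC<-; elim: (m - n)%N => [|j IH].
  by rewrite addn0; case: asc {S_chain} => x.
rewrite addnS; case: asc IH S_chain => IH S_chain x xS.
  exact/S_chain/IH.
exact/IH/S_chain.
Qed.

Lemma chain_condition_serre asc : serre (chain_condition asc).
Proof.
split.
- move=> U V i i_inj V_cc S S_closed S_chain.
  have [n|n|n nE] := V_cc
    (fun n => [pred y | `[< exists2 x, x \in S n & i x = y >]]).
  + exact: image_submod_closed.
  + exact: nested_image.
  have iS k x : `[< exists2 y, y \in S k & i y = i x >] = (x \in S k).
    by apply/asboolP/idP => [[y yS /i_inj <-]|xS] //; exists x.
  by exists n => m /nE mE x; have := mE (i x); rewrite !inE !iS.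
- move=> U V p p_surj U_cc S S_closed S_chain.
  have [n|n|n nE] := U_cc (fun n => [pred x | p x \in S n]).
  + exact: preim_submod_closed.
  + exact: nested_preim.
  by exists n => m /nE mE y; have [x <-] := p_surj y; apply: mE.
- move=> U V U_cc V_cc S S_closed S_chain.
  pose i : {linear U -> (U * V)%type} := mk_linear (pair_linear idfun \0).
  have [n|n|n nE] := U_cc (fun n => [pred x | i x \in S n]).
  + exact: preim_submod_closed.
  + exact: nested_preim.
  have [m|m|m mE] := V_cc
    (fun n => [pred y | `[< exists2 x, x \in S n & snd x = y >]]).
  + exact: (image_submod_closed snd).
  + exact: nested_image.
  (* From [N] on, both the trace on [U] and the projection to [V] are constant, which is the input
     of the modular law. *)
  pose N := maxn n m.
  exists N => k Nk; have nN : (n <= N)%N := leq_maxl _ _.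
  have mN : (m <= N)%N := leq_maxr _ _.
  have trace x : ((x, 0) \in S k) = ((x, 0) \in S N).
    have := etrans (nE k (leq_trans nN Nk) x) (esym (nE N nN x)).
    by rewrite !inE.
  have proj y : (exists x, (x, y) \in S k) <-> (exists x, (x, y) \in S N).
    have := etrans (mE k (leq_trans mN Nk) y) (esym (mE N mN y)).
    have E l : `[< exists2 x, x \in S l & x.2 = y >] =
               `[< exists x, (x, y) \in S l >].
      by apply: asbool_equiv_eq; split=> [[[x z] + <-]|[x xS]];
        [exists x | exists (x, y)].
    rewrite !inE !E => e.
    by split=> /asboolP h; apply/asboolP; rewrite ?e // -e.
  have := nested_le S_chain Nk; case: asc {U_cc V_cc S_chain} => sub.
    apply: prod_submod_eq => // [x|x y xyS]; first by rewrite trace.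
    by apply/proj; exists x.
  (* In a descending chain the later term is the smaller one, so the two sides change roles. *)
  apply: fsym; apply: prod_submod_eq => // [x|x y xyS]; first by rewrite trace.
  by apply/proj; exists x.
Qed.

Lemma noetherian_serre : serre (@noetherian R).
Proof. exact: (chain_condition_serre true). Qed.

Lemma artinian_serre : serre (@artinian R).
Proof. exact: (chain_condition_serre false). Qed.

End ChainConditions.

(** * Duality over R *)

(* Modules over A and over its opposite both restrict to R-modules, so what is
   proved for this dual applies to DL and DR alike. *)

Section RDual.
Variables (R : comPzRingType) (I : lmodType R).
Implicit Types U V : lmodType R.

Definition rdual U : Type := homs U I.

Section Structure.
Variable U : lmodType R.

HB.instance Definition _ := GRing.Zmodule.on (rdual U).

Fact rdualZ_linear a (f : {linear U -> I}) : linear (fun x => a *: f x).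
Proof. by move=> b x y; rewrite linearP scalerDr !scalerA mulrC. Qed.

Definition rdualZ a (f : rdual U) : rdual U := mk_linear (rdualZ_linear a f).

Fact rdualZA a b f : rdualZ a (rdualZ b f) = rdualZ (a * b) f.
Proof. by apply: linear_ext => x; apply: scalerA. Qed.
Fact rdual1Z : left_id 1 rdualZ.
Proof. by move=> f; apply: linear_ext => x; apply: scale1r. Qed.
Fact rdualZDr : right_distributive rdualZ +%R.
Proof. by move=> a f g; apply: linear_ext => x; apply: scalerDr. Qed.
Fact rdualZDl f : {morph rdualZ^~ f : a b / a + b}.
Proof. by move=> a b; apply: linear_ext => x; apply: scalerDl. Qed.
HB.instance Definition _ := GRing.Zmodule_isLmodule.Build R (rdual U)
  rdualZA rdual1Z rdualZDr rdualZDl.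

Definition rfun (f : rdual U) : {linear U -> I} := f.

Lemma rfun_linear x : linear (fun f : rdual U => rfun f x).
Proof. by []. Qed.

Definition reval x : rdual (rdual U) := mk_linear (rfun_linear x).

End Structure.

Lemma precomp_linear U V (f : {linear U -> V}) :
  linear (fun g : rdual V => (rfun g \o f : {linear U -> I}) : rdual U).
Proof. by move=> a g h; apply: linear_ext. Qed.

Definition rdual_map U V (f : {linear U -> V}) : {linear rdual V -> rdual U} :=
  mk_linear (precomp_linear f).

(** Only surjectivity of the evaluation is asked; its injectivity is automatic over a
    cogenerator. *)
Definition Rreflexive U := forall F : rdual (rdual U), exists x, reval x = F.

Hypotheses (I_inj : injective_module I) (I_cogen : cogenerator I).

(** The maps [r] to [r *: x] and zero from [R] differ, so the cogenerator tells them apart at some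
    [r]; then [f (r *: x)], and with it [f x], is nonzero. *)
Lemma separate_point U (x : U) : x <> 0 -> exists f : {linear U -> I}, f x <> 0.
Proof.
move=> x0.
have x_lin : linear (fun r : R^o => r *: x).
  by move=> a r s; rewrite scalerDl scalerA.
have [E|f [r]] := @I_cogen _ _ (mk_linear x_lin) \0.
  case: x0; rewrite -[x]scale1r.
  by have /= := congr1 (fun h : {linear R^o -> U} => h 1) E.
rewrite mk_linearE linear0 linearZ_LR => fx.
by exists f => fx0; case: fx; rewrite fx0 scaler0.
Qed.

Lemma separate_submod U (S : {pred U}) x : submod_closed S -> x \notin S ->
  exists f : {linear U -> I}, (forall y, y \in S -> f y = 0) /\ f x <> 0.
Proof.
move=> S_closed xS.
have [V [p [_ pE]]] := quotient_exists S_closed.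
have [|f fx] := @separate_point _ (p x); first by move/pE; apply/negP.
exists (f \o p); split=> // y /pE /= ->; exact: linear0.
Qed.

Lemma refl_serre : serre Rreflexive.
Proof.
split.
- move=> U V i i_inj V_refl F.
  have [y yE] := V_refl (rfun F \o rdual_map i : {linear _ -> _}).
  have [[x xy]|iy] := pselect (exists x, i x = y).
    exists x; apply: linear_ext => g.
    have [f fE] := I_inj g i_inj.
    transitivity (reval y f); first by rewrite /= -xy fE.
    rewrite yE; congr (rfun F _); exact: linear_ext.
  have i_closed : submod_closed [pred y | `[< exists2 x, x \in U & i x = y >]].
    by apply: image_submod_closed; split.
  (* If [y] lay outside the image of [i], some [f] would kill the image but not [y]; yet [f y] is
     the value of [F] at the restriction of [f] to [U], which is zero. *)
  have [|f [f0 []]] := separate_submod (x := y) i_closed.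
    by rewrite inE; apply/asboolP => -[x _ xy]; apply: iy; exists x.
  rewrite -[LHS]/(reval y f) yE /= -[RHS](linear0 (rfun F)); congr (rfun F _).
  by apply: linear_ext => x; apply: f0; rewrite inE; apply/asboolP; exists x.
- move=> U V p p_surj U_refl F.
  (* The dual of [V] embeds in that of [U], and injectivity of [I] extends [F] to the latter. *)
  have [|G GE] := @I_inj _ _ (rdual_map p) F.
    move=> f g fg; apply: linear_ext => y; have [x <-] := p_surj y.
    exact: (congr1 (fun h : rdual U => rfun h x) fg).
  have [x xE] := U_refl G.
  by exists (p x); apply: linear_ext => f; rewrite -GE -xE.
- move=> U V U_refl V_refl F.
  have [x xE] := U_refl (rfun F \o rdual_map fst : {linear _ -> _}).
  have [y yE] := V_refl (rfun F \o rdual_map snd : {linear _ -> _}).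
  exists (x, y); apply: linear_ext => f.
  pose f1 : {linear U -> I} := f \o mk_linear (pair_linear idfun \0).
  pose f2 : {linear V -> I} := f \o mk_linear (pair_linear \0 idfun).
  have -> : f = rdual_map fst f1 + rdual_map snd f2 :> rdual (U * V)%type.
    apply: linear_ext => -[u v]; rewrite /= /f1 /f2 /= -linearD /=.
    by congr (rfun f _); congr (_, _); rewrite /= ?addr0 ?add0r.
  rewrite [RHS](linearD (rfun F)).
  by congr (_ + _); [have := congr1 (fun h : rdual (rdual U) => rfun h f1) xE
    | have := congr1 (fun h : rdual (rdual V) => rfun h f2) yE].
Qed.

(** The functional to find is [F] composed with the evaluation of [U]; it suffices to compare on
    evaluations, as these exhaust the bidual. *)
Lemma rdual_refl U : Rreflexive U -> Rreflexive (rdual U).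
Proof.
move=> U_refl F.
have ev_lin : linear (fun x : U => rfun F (reval x)).
  move=> a x y; rewrite -linearP; congr (rfun F _).
  by apply: linear_ext => f; apply: (linearP (rfun f)).
exists (mk_linear ev_lin); apply: linear_ext => G.
by have [x <-] := U_refl G.
Qed.

(** The annihilators [T n] in [U] of a descending chain ascend, hence become stationary, and
    reflexivity recovers each submodule of the dual from its annihilator. *)
Lemma rdual_artinian U : noetherian U -> Rreflexive U -> artinian (rdual U).
Proof.
move=> U_noeth U_refl S S_closed S_decr.
pose T n := [pred x : U | `[< forall f : rdual U, f \in S n -> rfun f x = 0 >]].
have [n|n x|n nE] := U_noeth T.
- split=> [|a x y]; rewrite !inE; first by apply/asboolP => f _; exact: linear0.
  move=> /asboolP Tx /asboolP Ty; apply/asboolP => f fS.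
  by rewrite linearP Tx ?Ty // scaler0 addr0.
- by rewrite !inE => /asboolP Tx; apply/asboolP => f /S_decr; apply: Tx.
exists n => m nm f; apply/idP/idP.
  exact: (@nested_le _ _ false S).
move=> fS; apply/negPn/negP => fSm.
(* [F] vanishes on [S m] but not at [f]. It is evaluation at some [x], which lies in [T m], hence in
   [T n], and therefore kills [f]. *)
have [F [F0 []]] := separate_submod (S_closed m) fSm.
have [x xE] := U_refl F.
rewrite -xE; have : x \in T n.
  rewrite -(nE m nm) inE; apply/asboolP => g gS.
  by rewrite -[LHS]/(rfun (reval x) g) xE; apply: F0.
by rewrite inE => /asboolP; apply.
Qed.

End RDual.

(** * Transfer of conditions on R-modules to modules over an algebra *)

Section ModulesOverAnAlgebra.
Variables (R : comPzRingType) (B : algebra R) (T : lmodType R -> Prop).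
Hypothesis T_serre : serre T.

Lemma serre_restr : serre (fun M : lmodType B => T (restr M)).
Proof.
split=> [U V i i_inj|U V p p_surj|U V TU TV].
- exact: (serre_sub T_serre (i := restr_map i)).
- exact: (serre_quotient T_serre (p := restr_map p)).
(* The two ways to make the product an R-module share their operations, so the identity is an
   embedding between them. *)
have id_lin : linear (fun x : restr (U * V)%type => (x : (restr U * restr V)%type)).
  by [].
apply: (serre_sub T_serre (i := mk_linear id_lin)) => //.
exact: (serre_prod T_serre).
Qed.

Lemma serre_direct_sum (U : lmodType R) n :
  T U -> T (direct_sum (fun _ : 'I_n => U)).
Proof.
move=> TU; elim: n => [|n TUn].
  apply: (serre_quotient T_serre (p := \0 : {linear U -> _})) TU => y.
  by exists 0; apply: functional_extensionality_dep => -[].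
(* Coordinate [ord0] receives the first component and [lift ord0 j] the coordinate [j] of the
   second, which exhibits the larger sum as a quotient of a product. *)
pose f (x : (U * direct_sum (fun _ : 'I_n => U))%type) :
  direct_sum (fun _ : 'I_n.+1 => U) := fun i => oapp x.2 x.1 (unlift ord0 i).
have f_lin : linear f.
  move=> a x y; apply: functional_extensionality_dep => i.
  by rewrite -[RHS]/(a *: f x i + f y i) /f; case: unlift.
apply: (serre_quotient T_serre (p := mk_linear f_lin)) (serre_prod T_serre TU TUn).
move=> y; exists (y ord0, fun i => y (lift ord0 i)).
apply: functional_extensionality_dep => i; rewrite mk_linearE /f.
by case: unliftP => [j|] ->.
Qed.

Lemma serre_finitely_generated (M : lmodType B) :
  T (restr B^o) -> finitely_generated M -> T (restr M).
Proof.
move=> TB [n [e e_gen]].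
pose f (a : direct_sum (fun _ : 'I_n => restr B^o)) : restr M :=
  \sum_(i < n) (a i : B) *: e i.
have f_lin : linear f.
  move=> r a b; rewrite -[r *: f a]/(alg_map B r *: (f a : M)) /f scaler_sumr.
  rewrite -[RHS]big_split; apply: eq_bigr => i _.
  by rewrite [LHS]scalerDl scalerA.
apply: (serre_quotient T_serre (p := mk_linear f_lin)) (serre_direct_sum _ TB).
by move=> x; have [a xE] := e_gen x; exists a.
Qed.

End ModulesOverAnAlgebra.

(** Otherwise every finite list misses some element of [M]; adjoining such elements one by one gives
    spans over [B], in particular R-submodules, that increase strictly. *)
Lemma noetherian_finitely_generated (R : comPzRingType) (B : algebra R)
  (M : lmodType B) : R_noetherian M -> finitely_generated M.
Proof.
move=> M_noeth.
pose span (s : seq M) (x : M) :=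
  exists a : 'I_(size s) -> B, x = \sum_(i < size s) a i *: s`_i.
have [[s s_gen]|not_fg] := pselect (exists s, forall x, span s x).
  by exists (size s), (fun i => s`_i).
have /choice[next nextP] s : exists x, ~ span s x.
  by apply/existsNP => s_gen; apply: not_fg; exists s.
pose grow s := next s :: s.
pose S n : {pred restr M} := [pred x | `[< span (iter n grow [::]) x >]].
have [n|n x|n /(_ n.+1 (leqnSn n)) nE] := M_noeth S.
- split=> [|r x y]; rewrite !inE.
    by apply/asboolP; exists (fun=> 0); rewrite big1 // => i _; rewrite scale0r.
  move=> /asboolP[a aE] /asboolP[b ->]; apply/asboolP.
  exists (fun i => alg_map B r * a i + b i).
  rewrite -[r *: x]/(alg_map B r *: (x : M)) aE scaler_sumr -[LHS]big_split.
  apply: eq_bigr => i _.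
  by rewrite scalerDl scalerA.
- rewrite !inE => /asboolP[a ->]; apply/asboolP.
  (* The new generator is at the head of the list and gets coefficient 0; the strictness argument
     below gives it coefficient 1 instead. *)
  exists (fun i => oapp a 0 (unlift ord0 i)).
  rewrite big_ord_recl unlift_none scale0r add0r.
  by apply: eq_bigr => i _; rewrite liftK.
have /= := nE (next (iter n grow [::])); rewrite !inE => E.
suff : `[< span (iter n.+1 grow [::]) (next (iter n grow [::])) >].
  by rewrite E => /asboolP/nextP.
apply/asboolP; exists (fun i => oapp (fun=> 0) 1 (unlift ord0 i)).
rewrite big_ord_recl unlift_none scale1r big1 ?addr0 // => i _.
by rewrite liftK scale0r.
Qed.

(** * Finitely generated projective modules *)

Section DualBasis.
Variable K : pzRingType.

Lemma homs_sumE (U V : lmodType K) n (F : 'I_n -> homs U V) x :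
  ((\sum_(i < n) F i : homs U V) : {linear U -> V}) x
  = \sum_(i < n) (F i : {linear U -> V}) x.
Proof.
exact: (big_morph (fun f : homs U V => (f : {linear U -> V}) x)).
Qed.

Definition dual_basis (M : lmodType K) n
    (e : 'I_n -> M) (u : 'I_n -> {linear M -> K^o}) :=
  forall x, x = \sum_(i < n) (u i x : K) *: e i.

Lemma dual_basis_finitely_generated (M : lmodType K) n (e : 'I_n -> M) u :
  dual_basis e u -> finitely_generated M.
Proof. by move=> eu; exists n, e => x; exists (fun i => u i x). Qed.

(** The dual basis lemma. The [u i] are the coordinates of a splitting of the surjection from a free
    module; conversely, lifts of the [e i] weighted by the [u i] lift any map. *)
Lemma dual_basisP (M : lmodType K) :
  (finitely_generated M /\ projective M) <->
  exists n e u, @dual_basis M n e u.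
Proof.
split=> [[[n [e e_gen]] M_proj]|[n [e [u eu]]]].
  pose f (a : direct_sum (fun _ : 'I_n => K^o)) : M := \sum_(i < n) (a i : K) *: e i.
  have f_lin : linear f.
    move=> r a b; rewrite /f scaler_sumr -big_split.
    by apply: eq_bigr => i _; rewrite [LHS]scalerDl scalerA.
  have [y|g gE] := M_proj _ _ (mk_linear f_lin) idfun.
    by have [a ->] := e_gen y; exists a.
  have u_lin i : linear (fun x => g x i : K^o) by move=> r x y; rewrite linearP.
  by exists n, e, (fun i => mk_linear (u_lin i)) => x; rewrite -[LHS]gE.
split; first exact: dual_basis_finitely_generated eu.
move=> U V p f p_surj.
have [y yE] := choice (fun i => p_surj (f (e i))).
have g_lin : linear (fun x => \sum_(i < n) (u i x : K) *: y i).
  move=> r a b; rewrite scaler_sumr -big_split; apply: eq_bigr => i _.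
  by rewrite linearP [LHS]scalerDl; congr (_ + _); exact/esym/scalerA.
exists (mk_linear g_lin) => x; rewrite mk_linearE linear_sum [in RHS](eu x) linear_sum.
by apply: eq_bigr => i _; rewrite !linearZ_LR yE.
Qed.

End DualBasis.

(** * Biduality of finitely generated projectives over A *)

Section BidualOverA.
Variables (R : comPzRingType) (A : algebra R).

Lemma homL_eval_linear1 (P : lmodType A) (x : P) :
  linear (fun f : HomL A P => (f : {linear P -> A^o}) x : A^c^o).
Proof. by []. Qed.

Lemma homL_eval_linear (P : lmodType A) :
  linear (fun x : P => mk_linear (homL_eval_linear1 x) : HomR A (HomL A P)).
Proof.
move=> a x y; apply: linear_ext => f.
exact: (linearP (f : {linear P -> A^o})).
Qed.

Definition homL_eval (P : lmodType A) : {linear P -> HomR A (HomL A P)} :=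
  mk_linear (@homL_eval_linear P).

Lemma homR_eval_linear1 (Q : lmodType A^c) (x : Q) :
  linear (fun f : HomR A Q => (f : {linear Q -> A^c^o}) x : A^o).
Proof. by []. Qed.

Lemma homR_eval_linear (Q : lmodType A^c) :
  linear (fun x : Q => mk_linear (homR_eval_linear1 x) : HomL A (HomR A Q)).
Proof.
move=> a x y; apply: linear_ext => f.
exact: (linearP (f : {linear Q -> A^c^o})).
Qed.

Definition homR_eval (Q : lmodType A^c) : {linear Q -> HomL A (HomR A Q)} :=
  mk_linear (@homR_eval_linear Q).

(** Generators and coordinates exchange roles: the [u i] generate, and evaluations at the [e i] are
    their coordinates. *)
Lemma homL_dual_basis (P : lmodType A) n (e : 'I_n -> P) u : dual_basis e u ->
  @dual_basis A^c (HomL A P) n u (fun i => homL_eval P (e i)).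
Proof.
move=> eu v; apply: linear_ext => x; rewrite homs_sumE.
rewrite [in LHS](eu x) linear_sum; apply: eq_bigr => i _.
by rewrite linearZ_LR.
Qed.

Lemma homR_dual_basis (Q : lmodType A^c) n (e : 'I_n -> Q) u : dual_basis e u ->
  @dual_basis A (HomR A Q) n u (fun i => homR_eval Q (e i)).
Proof.
move=> eu v; apply: linear_ext => x; rewrite homs_sumE.
rewrite [in LHS](eu x) linear_sum; apply: eq_bigr => i _.
by rewrite linearZ_LR.
Qed.

(** The inverse sends [F] to the sum of the [F (u i) *: e i]. *)
Lemma homL_eval_bij (P : lmodType A) n (e : 'I_n -> P) u : dual_basis e u ->
  injective (homL_eval P) /\ forall F, exists x, homL_eval P x = F.
Proof.
move=> eu; split.
  apply: linear_inj => x x0; rewrite [x]eu big1 // => i _.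
  have -> : u i x = 0; last by rewrite scale0r.
  exact: (congr1 (fun F : {linear homL P -> A^c^o} => F (u i)) x0).
move=> F; exists (\sum_(i < n) ((F : {linear homL P -> A^c^o}) (u i) : A) *: e i).
apply: linear_ext => v; rewrite [in RHS](homL_dual_basis eu v) !linear_sum.
rewrite homs_sumE; apply: eq_bigr => i _.
by rewrite !linearZ_LR.
Qed.

Lemma homR_eval_bij (Q : lmodType A^c) n (e : 'I_n -> Q) u : dual_basis e u ->
  injective (homR_eval Q) /\ forall F, exists x, homR_eval Q x = F.
Proof.
move=> eu; split.
  apply: linear_inj => x x0; rewrite [x]eu big1 // => i _.
  have -> : u i x = 0; last by rewrite scale0r.
  exact: (congr1 (fun F : {linear homR Q -> A^o} => F (u i)) x0).
move=> F; exists (\sum_(i < n) ((F : {linear homR Q -> A^o}) (u i) : A^c) *: e i).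
apply: linear_ext => v; rewrite [in RHS](homR_dual_basis eu v) !linear_sum.
rewrite homs_sumE; apply: eq_bigr => i _.
by rewrite !linearZ_LR.
Qed.

End BidualOverA.

(** * Finitely cogenerated modules *)

Section Duals.
Variables (R : comPzRingType) (I : lmodType R) (A : algebra R).
Implicit Types (M : lmodType A) (N : lmodType A^c).

Local Notation op_restr := (@restr R (op_algebra A)).

(** A scalar of [R] acts on the argument on one side and on the value on the other; R-linearity of
    [f] identifies the two actions. *)
Lemma op_restr_dualL_linear M :
  linear (fun f : op_restr (DL I A M) => (f : rdual I (restr M))).
Proof.
move=> r f g; congr (_ + _); apply: linear_ext => x.
exact: (linearZ_LR (f : {linear restr M -> I}) r (x : restr M)).
Qed.

Lemma restr_dualR_linear N :
  linear (fun f : restr (DR I A N) => (f : rdual I (op_restr N))).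
Proof.
move=> r f g; congr (_ + _); apply: linear_ext => x.
exact: (linearZ_LR (f : {linear op_restr N -> I}) r (x : op_restr N)).
Qed.

Definition sigmaR_fun N (x : N) (f : restr (DR I A N)) : I :=
  (f : {linear op_restr N -> I}) x.

Fact sigmaR_fun_linear N x : linear (@sigmaR_fun N x).
Proof. by move=> r f g; rewrite /sigmaR_fun (@restr_dualR_linear N r f g). Qed.

Fact sigmaR_linear N :
  linear (fun x => mk_linear (@sigmaR_fun_linear N x) : DL I A (DR I A N)).
Proof.
move=> a x y; apply: linear_ext => f.
exact: (linearD (f : {linear op_restr N -> I}) (a *: x : op_restr N) (y : op_restr N)).
Qed.

Definition sigmaR N : {linear N -> DL I A (DR I A N)} :=
  mk_linear (@sigmaR_linear N).

Hypotheses (I_inj : injective_module I) (I_cogen : cogenerator I).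

Lemma sigma_inj M : injective (@sigma R I A M).
Proof.
apply: (@linear_inj _ _ _ (@sigma R I A M)) => x x0.
apply: contrapT => /(separate_point I_cogen (U := restr M))[f]; apply.
exact: (congr1 (fun F : {linear op_restr (DL I A M) -> I} => F f) x0).
Qed.

Lemma sigmaR_inj N : injective (sigmaR N).
Proof.
apply: linear_inj => x x0.
apply: contrapT => /(separate_point I_cogen (U := op_restr N))[f]; apply.
exact: (congr1 (fun F : {linear restr (DR I A N) -> I} => F f) x0).
Qed.

Lemma sigma_surj M : Rreflexive I (restr M) -> forall F, exists x : M, sigma I x = F.
Proof.
move=> M_refl F; have F_lin : linear (fun f : rdual I (restr M) =>
    (F : {linear op_restr (DL I A M) -> I}) (f : op_restr (DL I A M))).
  move=> r f g; rewrite -linearP; congr ((F : {linear _ -> _}) _).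
  exact/esym/op_restr_dualL_linear.
have [x xE] := M_refl (mk_linear F_lin).
exists x; apply: linear_ext => f.
exact: (congr1 (fun G : rdual I (rdual I (restr M)) => rfun G f) xE).
Qed.

Lemma sigmaR_surj N : Rreflexive I (op_restr N) -> forall F, exists x, sigmaR N x = F.
Proof.
move=> N_refl F; have F_lin : linear (fun f : rdual I (op_restr N) =>
    (F : {linear restr (DR I A N) -> I}) (f : restr (DR I A N))).
  move=> r f g; rewrite -linearP; congr ((F : {linear _ -> _}) _).
  exact/esym/restr_dualR_linear.
have [x xE] := N_refl (mk_linear F_lin).
exists x; apply: linear_ext => f.
exact: (congr1 (fun G : rdual I (rdual I (op_restr N)) => rfun G f) xE).
Qed.

Lemma reflexive_moduleE M : reflexive_module I M <-> Rreflexive I (restr M).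
Proof.
split=> [[g _ gK] F|M_refl].
  have F_lin : linear (fun f : op_restr (DL I A M) => rfun F f).
    by move=> r f g'; rewrite op_restr_dualL_linear linearP.
  exists (g (mk_linear F_lin)); apply: linear_ext => f.
  exact: (congr1 (fun G : {linear op_restr (DL I A M) -> I} => G f)
    (gK (mk_linear F_lin))).
have [g [gK Kg]] := linear_inverse (@sigma_inj M) (sigma_surj M_refl).
by exists g.
Qed.

(** By centrality [A] and its opposite are the same R-module, so one assumption on the left regular
    module serves both sides. *)
Lemma serre_restr_op_regular (T : lmodType R -> Prop) :
  serre T -> T (restr A^o) -> T (op_restr A^c^o).
Proof.
move=> T_serre.
have id_lin : linear (fun x : op_restr A^c^o => (x : restr A^o)).
  move=> r x y; congr (_ + _).
  exact: (esym (alg_central r (x : A))).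
exact: (serre_sub T_serre (i := mk_linear id_lin)).
Qed.

Lemma serre_restr_dualR (T : lmodType R -> Prop) N :
  serre T -> T (rdual I (op_restr N)) -> T (restr (DR I A N)).
Proof.
move=> T_serre.
exact: (serre_sub T_serre (i := mk_linear (@restr_dualR_linear N))).
Qed.

Definition cogenerated_by M n (phi : 'I_n -> {linear restr M -> I}) :=
  forall x : M, (forall i (a : A), phi i (a *: x) = 0) -> x = 0.

Definition finitely_cogenerated M :=
  exists n (phi : 'I_n -> {linear restr M -> I}), cogenerated_by phi.

(** Dual to the noetherian argument: if a finite list annihilates some nonzero [x], a functional
    nonzero at [x] is adjoined, and the annihilators decrease strictly. *)
Lemma artinian_finitely_cogenerated M : R_artinian M -> finitely_cogenerated M.
Proof.
move=> M_art.
pose ann (s : seq (rdual I (restr M))) (x : M) :=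
  forall f, f \in s -> forall a : A, rfun f (a *: x) = 0.
have [[s s_cogen]|not_fcg] := pselect (exists s, forall x, ann s x -> x = 0).
  exists (size s), (fun i => rfun s`_i) => x x0; apply: s_cogen => f fs a.
  have fi : (index f s < size s)%N by rewrite index_mem.
  by have := x0 (Ordinal fi) a; rewrite /= nth_index.
have nextP s : exists f : rdual I (restr M), exists2 x, ann s x & rfun f x <> 0.
  have /existsNP[x] : ~ (forall x, ann s x -> x = 0).
    by move=> s_cogen; apply: not_fcg; exists s.
  move=> /not_implyP[sx /(separate_point I_cogen (U := restr M))[f fx]].
  by exists f, x.
have {nextP}[next nextP] := choice nextP.
pose grow s := next s :: s.
pose S n : {pred restr M} := [pred x | `[< ann (iter n grow [::]) x >]].
have [n|n x|n /(_ n.+1 (leqnSn n)) nE] := M_art S.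
- split=> [|r x y]; rewrite !inE.
    by apply/asboolP => f _ a; rewrite [X in rfun f X]scaler0 linear0.
  move=> /asboolP sx /asboolP sy; apply/asboolP => f fs a.
  have -> : a *: (r *: x + y : M) = r *: (a *: (x : M) : restr M) + a *: (y : M).
    rewrite [LHS](@scalerDr A); congr (_ + _).
    by rewrite [LHS]scalerA [RHS]scalerA alg_central.
  by rewrite linearP sx // sy // scaler0 addr0.
- rewrite !inE => /asboolP sx; apply/asboolP => f fs.
  by apply: sx; rewrite inE fs orbT.
have [x sx []] := nextP (iter n grow [::]).
have := nE x; rewrite !inE => E.
have : `[< ann (iter n grow [::]) x >] by apply/asboolP.
rewrite -E => /asboolP /(_ (next (iter n grow [::]))) /=.
by rewrite inE eqxx => /(_ isT 1); rewrite scale1r.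
Qed.

Section FinitelyCogenerated.
Variables (M : lmodType A) (n : nat) (phi : 'I_n -> {linear restr M -> I}).
Hypothesis phi_cogen : cogenerated_by phi.
Hypotheses (A_noeth : noetherian_algebra A) (A_refl : reflexive_algebra I A).

Definition right_free : lmodType A^c := direct_sum (fun _ : 'I_n => A^c^o).

Lemma right_free_fg : @finitely_generated A^c right_free.
Proof.
exists n, (fun i j => (i == j)%:R) => x; exists x.
apply: functional_extensionality_dep => j.
rewrite (big_morph (fun y : right_free => y j) (id1 := 0) (op1 := +%R)) //.
rewrite (bigD1 j) //= big1 ?addr0 => [|i ij].
  by rewrite [RHS]/GRing.scale /= /dsumZ eqxx; apply/esym/(@mulr1 A^c).
by rewrite [LHS]/GRing.scale /= /dsumZ (negPf ij); apply: (@mulr0 A^c).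
Qed.

Lemma op_finitely_generated (T : lmodType R -> Prop) N :
  serre T -> T (restr A^o) -> @finitely_generated A^c N -> T (op_restr N).
Proof.
move=> T_serre TA; apply: (serre_finitely_generated (B := op_algebra A)) => //.
exact: serre_restr_op_regular.
Qed.

Lemma op_noetherian N : @finitely_generated A^c N -> noetherian (op_restr N).
Proof. by apply: op_finitely_generated A_noeth; apply: noetherian_serre. Qed.

Lemma op_refl N : @finitely_generated A^c N -> Rreflexive I (op_restr N).
Proof.
apply: op_finitely_generated; first exact: refl_serre.
by apply/reflexive_moduleE.
Qed.

(** This pairing of [M] with tuples over [A] defines the map from [M] to the dual of the free right
    module, injective exactly because the [phi i] cogenerate. *)
Lemma cogen_map_linear1 x : linear (fun a : op_restr right_free =>
  \sum_(i < n) phi i ((a i : A) *: (x : M))).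
Proof.
move=> r a b; rewrite scaler_sumr -big_split; apply: eq_bigr => i _.
rewrite -[RHS]linearP; congr (phi i _).
rewrite [LHS]scalerDl; congr (_ + _); rewrite [RHS]scalerA.
exact: (congr1 (fun c : A => c *: x) (esym (alg_central r (a i : A)))).
Qed.

Lemma cogen_map_linear :
  linear (fun x : M => mk_linear (cogen_map_linear1 x) : DR I A right_free).
Proof.
move=> a x y; apply: linear_ext => b.
rewrite -[RHS]/(\sum_(i < n) phi i ((b i : A) * a *: x) +
  \sum_(i < n) phi i ((b i : A) *: y)) -big_split; apply: eq_bigr => i _.
rewrite -[RHS]linearD; congr (phi i _).
by rewrite [LHS]scalerDr scalerA.
Qed.

Definition cogen_map : {linear M -> DR I A right_free} := mk_linear cogen_map_linear.

Lemma cogen_map_inj : injective cogen_map.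
Proof.
apply: linear_inj => x x0; apply: phi_cogen => i a.
(* At the tuple with [a] in position [i] and zeros elsewhere the pairing is [phi i (a *: x)]. *)
pose b : op_restr right_free := fun j => if j == i then (a : A^c^o) else 0.
have /= := congr1 (fun f : {linear op_restr right_free -> I} => f b) x0.
rewrite /mk_linear /= (bigD1 i) //= big1 ?addr0 => [|j ji].
  by rewrite /b eqxx.
by rewrite /b (negPf ji) [X in phi j X]scale0r linear0.
Qed.

Lemma finitely_cogenerated_artinian : R_artinian M.
Proof.
apply: (serre_sub (serre_restr A (artinian_serre R)) cogen_map_inj).
apply: (serre_restr_dualR (artinian_serre R)).
apply: rdual_artinian => //; first exact/op_noetherian/right_free_fg.
exact/op_refl/right_free_fg.
Qed.

Lemma finitely_cogenerated_refl : Rreflexive I (restr M).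
Proof.
apply: (serre_sub (serre_restr A (refl_serre I_inj I_cogen)) cogen_map_inj).
apply: (serre_restr_dualR (refl_serre I_inj I_cogen)).
exact/rdual_refl/op_refl/right_free_fg.
Qed.

(** Up to the bidual of the free module, the dual of [cogen_map] is the map that sends the standard
    basis to the [phi i]. *)
Lemma sigmaR_cogen_map (b : right_free) :
  dualL_map cogen_map (sigmaR right_free b)
  = \sum_(i < n) (b i : A^c) *: (phi i : DL I A M).
Proof.
apply: linear_ext => x; rewrite homs_sumE.
by apply: eq_bigr.
Qed.

(** Injectivity of [I] extends [f] along [cogen_map], and reflexivity of the free module turns the
    extension into evaluation at a tuple [b]. *)
Lemma finitely_cogenerated_dual_generated (f : DL I A M) :
  exists b : right_free, f = \sum_(i < n) (b i : A^c) *: (phi i : DL I A M).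
Proof.
have [g gE] :=
  I_inj (f : {linear restr M -> I}) (i := restr_map cogen_map) cogen_map_inj.
have [b bE] := sigmaR_surj (op_refl right_free_fg) (g : DL I A (DR I A right_free)).
exists b; rewrite -sigmaR_cogen_map bE.
by apply: linear_ext => x; rewrite -gE.
Qed.

Lemma finitely_cogenerated_dual_fg : @finitely_generated A^c (DL I A M).
Proof.
exists n, phi => f; have [b ->] := finitely_cogenerated_dual_generated f.
by exists b.
Qed.

End FinitelyCogenerated.

End Duals.

(** * Injective modules and natural isomorphisms *)

Lemma is_iso_bij (K : pzRingType) (U V : Mod K) (f : {linear U -> V}) :
  is_iso (f : Defs.hom U V) -> injective f /\ forall y, exists x, f x = y.
Proof.
move=> [g [gf fg]].
have gK : cancel f g := fun x => congr1 (fun h : {linear U -> U} => h x) gf.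
have Kg : cancel g f := fun y => congr1 (fun h : {linear V -> V} => h y) fg.
by split=> [|y]; [exact: can_inj gK | exists (g y)].
Qed.

Lemma bij_is_iso (K : pzRingType) (U V : Mod K) (f : {linear U -> V}) :
  injective f -> (forall y, exists x, f x = y) -> is_iso (f : Defs.hom U V).
Proof.
move=> f_inj f_surj; have [g [fg gf]] := linear_inverse f_inj f_surj.
by exists g; split; apply: linear_ext.
Qed.

Lemma cofunctor_iso (C D : category) (F : cofunctor C D) (X Y : C)
  (f : Defs.hom X Y) : is_iso f -> is_iso (cfmap F f).
Proof.
by move=> [g [gf fg]]; exists (cfmap F g); rewrite -!cfmapM gf fg !cfmap1.
Qed.

Lemma cofunctor_bij (K L : pzRingType) (F : cofunctor (Mod K) (Mod L))
    (U V : lmodType K) (f : {linear U -> V}) :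
  injective f -> (forall y, exists x, f x = y) ->
  let Ff := cfmap F f : {linear F V -> F U} in
  injective Ff /\ forall y, exists x, Ff x = y.
Proof. by move=> f_inj f_surj; apply/is_iso_bij/cofunctor_iso/bij_is_iso. Qed.

(** The isomorphism is [a] followed by the inverse of [b]. The middle term [H] may lie outside [P],
    so double duals can serve without a membership proof. *)
Lemma natural_iso_cospan (C : category) (K : pzRingType) (P : Mod K -> Prop)
    (F G : functor C (full P)) (H : C -> lmodType K)
    (Hmap : forall X Y, Defs.hom X Y -> {linear H X -> H Y})
    (a : forall X, {linear carrier (F X) -> H X})
    (b : forall X, {linear carrier (G X) -> H X}) :
  (forall X, injective (a X) /\ forall y, exists x, a X x = y) ->
  (forall X, injective (b X) /\ forall y, exists x, b X x = y) ->
  (forall X Y f x, a Y (umap (fmap F f) x) = Hmap X Y f (a X x)) ->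
  (forall X Y f x, b Y (umap (fmap G f) x) = Hmap X Y f (b X x)) ->
  natural_iso F G.
Proof.
move=> a_bij b_bij a_nat b_nat.
have t_ex X : exists t : {linear carrier (F X) -> carrier (G X)},
    forall x, b X (t x) = a X x.
  by apply: lift_through_inj => [|x]; [have [] := b_bij X | apply: (b_bij X).2].
pose t X := sval (cid (t_ex X)).
have tE X x : b X (t X x) = a X x by rewrite /t; case: cid.
exists t; split=> [X Y f|X].
  apply: linear_ext => x; apply: (b_bij Y).1.
  transitivity (a Y (umap (fmap F f) x)); first exact: tE.
  rewrite a_nat -tE; exact/esym/b_nat.
apply: (@bij_is_iso K (carrier (F X)) (carrier (G X))) => [x y txy|y].
  by apply: (a_bij X).1; rewrite -!tE txy.
have [x xE] := (a_bij X).2 (b X y).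
by exists x; apply: (b_bij X).1; rewrite tE.
Qed.

(** * Injective modules as duals of finitely generated projectives *)

Section Injectives.
Variables (R : comPzRingType) (I : lmodType R) (A : algebra R).
Implicit Types (M P E : lmodType A) (Q : lmodType A^c).

Local Notation op_restr := (@restr R (op_algebra A)).

(** Serves for a direct sum, where functionals are indexed by pairs of a summand and an index within
    it. *)
Lemma finitely_cogenerated_fintype M (T : finType)
    (phi : T -> {linear restr M -> I}) :
  (forall x : M, (forall t (a : A), phi t (a *: x) = 0) -> x = 0) ->
  finitely_cogenerated I M.
Proof.
move=> phi_cogen; exists #|T|, (fun i => phi (enum_val i)) => x x0.
by apply: phi_cogen => t a; rewrite -(enum_rankK t).
Qed.

Lemma inj_finitely_cogenerated E : inj I E -> finitely_cogenerated I E.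
Proof.
move=> [P [/dual_basisP[n [e [u eu]]] [f /is_iso_bij[f_inj _]]]].
have phi_lin i : linear (fun x : restr E =>
    (f x : {linear op_restr (HomL A P) -> I}) (u i : HomL A P)).
  move=> r x y.
  have -> : f (r *: x + y) = alg_map A r *: f x + f y by apply: linearP.
  congr (_ + _).
  exact: (linearZ_LR (f x : {linear op_restr (HomL A P) -> I}) r
    (u i : op_restr (HomL A P))).
exists n, (fun i => mk_linear (phi_lin i)) => x x0.
apply: f_inj; rewrite linear0; apply: linear_ext => v.
rewrite [in LHS](homL_dual_basis eu v) linear_sum big1 // => i _.
(* The coefficient of [u i] in [v] moves across the pairing onto [x], where the cogeneration
   hypothesis applies. *)
pose c : A := homL_eval P (e i) v.
have fx : c *: f x = f (c *: x) by apply/esym/linearZ_LR.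
exact: (etrans (congr1 (fun F : {linear op_restr (HomL A P) -> I} => F (u i)) fx)
  (x0 i c)).
Qed.

Lemma mod_minus_finitely_cogenerated M : mod_minus I M -> finitely_cogenerated I M.
Proof.
move=> [n [E [E_inj [j j_inj]]]].
have phi_ex i : exists s : {k : nat & 'I_k -> {linear restr (E i) -> I}},
    cogenerated_by (projT2 s).
  have [k [phi phi_cogen]] := inj_finitely_cogenerated (E_inj i).
  by exists (existT _ k phi).
pose s i := sval (cid (phi_ex i)).
have sP i : cogenerated_by (projT2 (s i)) by rewrite /s; case: cid.
have psi_lin (t : {i : 'I_n & 'I_(projT1 (s i))}) :
    linear (fun x : restr M => projT2 (s (tag t)) (tagged t) (j x (tag t))).
  move=> r x y; rewrite -linearP; congr (projT2 (s _) _ _).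
  exact: (congr1 (fun z : direct_sum E => z (tag t)) (linearP j _ x y)).
apply: (finitely_cogenerated_fintype (phi := fun t => mk_linear (psi_lin t))).
move=> x x0; apply: j_inj; rewrite linear0.
apply: functional_extensionality_dep => i; apply: sP => k a.
have := x0 (Tagged _ k) a; rewrite mk_linearE /=.
have -> : j (a *: x) = a *: j x by apply: linearZ_LR.
by [].
Qed.

Lemma regular_dual_basis (K : pzRingType) :
  dual_basis (fun _ : 'I_1 => 1 : K^o) (fun _ => idfun).
Proof. by move=> x; rewrite big_ord1; apply/esym/(@mulr1 K). Qed.

Lemma regular_proj : @proj R A A^o.
Proof.
apply/dual_basisP; exists 1%N, (fun=> 1), (fun=> idfun).
exact: regular_dual_basis.
Qed.

(** The regular module supplies the targets: a map [v] from [A] to itself is fixed by [v 1], and [x]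
    goes to the functional with value [phi i (v 1 *: x)] at [v]. *)
Lemma finitely_cogenerated_mod_minus M : finitely_cogenerated I M -> mod_minus I M.
Proof.
move=> [n [phi phi_cogen]].
have lin1 i (x : M) : linear (fun v : op_restr (HomL A A^o) =>
    phi i (((v : {linear A^o -> A^o}) 1 : A) *: x)).
  move=> r v w; rewrite -linearP; congr (phi i _).
  rewrite [LHS]scalerDl; congr (_ + _); rewrite [RHS]scalerA.
  exact: (congr1 (fun c : A => c *: x) (esym (alg_central r _))).
have lin i : linear (fun x : M => mk_linear (lin1 i x) : nu I A A^o).
  move=> a x y; apply: linear_ext => v; rewrite /mk_linear /=.
  rewrite -[RHS](linearD (phi i)); congr (phi i _).
  by rewrite [LHS]scalerDr scalerA.
exists n, (fun=> nu I A A^o : lmodType A); split=> [i|].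
  exists (A^o : Mod A); split; first exact: regular_proj.
  by exists (idm _); exists (idm _); split; apply: linear_ext.
have j_lin : linear (fun x : M =>
    (fun i => mk_linear (lin i) x)
      : direct_sum (fun _ : 'I_n => nu I A A^o : lmodType A)).
  move=> a x y; apply: functional_extensionality_dep => i.
  exact: (linearP (mk_linear (lin i))).
exists (mk_linear j_lin); apply: linear_inj => x x0; apply: phi_cogen => i a.
(* The test map is right multiplication by [a], whose value at 1 is [a]. *)
have := congr1 (fun F : {linear op_restr (HomL A A^o) -> I} =>
  F ((a : A^c) *: (idfun : HomL A A^o)))
  (congr1 (fun z : direct_sum _ => z i) x0).
by rewrite /= /mk_linear /= /homL_fun /= mul1r.
Qed.

(** A map into the dual of [Q] is determined by its values at the [e k]. These are R-linear maps to
    [I]; each extends along [i], and the coordinates [u k] reassemble the extensions. *)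
Lemma dualR_injective Q n (e : 'I_n -> Q) u : injective_module I ->
  dual_basis e u -> injective_module (DR I A Q : lmodType A).
Proof.
move=> I_inj eu U V i f i_inj.
pose ev k (F : restr (DR I A Q)) : I := (F : {linear op_restr Q -> I}) (e k).
have ev_lin k : linear (ev k).
  by move=> r F G; rewrite /ev (restr_dualR_linear r F G).
have /choice[g gE] k : exists g : {linear restr V -> I}, forall x : U,
    g (i x) = ev k (f x).
  have [g gE] :=
    I_inj _ _ (restr_map i) (mk_linear (ev_lin k) \o restr_map f) i_inj.
  by exists g.
have G_lin1 (v : V) : linear (fun q : op_restr Q =>
    \sum_(k < n) g k ((u k q : A) *: v)).
  move=> r p q; rewrite scaler_sumr -big_split; apply: eq_bigr => k _.
  rewrite -[RHS]linearP; congr (g k _).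
  have -> : u k (r *: p + q) = (alg_map A r : A^c) * u k p + u k q by apply: linearP.
  rewrite [LHS]scalerDl; congr (_ + _); rewrite [RHS]scalerA.
  exact: (congr1 (fun c : A => c *: v) (esym (alg_central r _))).
have G_lin : linear (fun v : V => mk_linear (G_lin1 v) : DR I A Q).
  move=> a v w; apply: linear_ext => q.
  rewrite -[RHS]/(\sum_(k < n) g k ((u k ((a : A^c) *: q) : A) *: v) +
    \sum_(k < n) g k ((u k q : A) *: w)) -big_split; apply: eq_bigr => k _.
  rewrite -[RHS]linearD; congr (g k _).
  have -> : u k ((a : A^c) *: q) = (u k q : A) * a by apply: linearZ_LR.
  by rewrite [LHS]scalerDr scalerA.
exists (mk_linear G_lin) => x; apply: linear_ext => q.
rewrite [in RHS](eu q) linear_sum; apply: eq_bigr => k _.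
have -> : (u k q : A) *: i x = i ((u k q : A) *: x) by rewrite linearZ_LR.
rewrite gE /ev.
by have -> : f ((u k q : A) *: x) = (u k q : A) *: f x by apply: linearZ_LR.
Qed.

Lemma inj_injective E : injective_module I -> inj I E -> injective_module E.
Proof.
move=> I_inj [P [/dual_basisP[n [e [u eu]]] [s [s' [s'K _]]]]] U V i f i_inj.
have [g gE] := dualR_injective I_inj (homL_dual_basis eu)
  ((s : {linear E -> nu I A P}) \o f) i_inj.
exists ((s' : {linear nu I A P -> E}) \o g) => x /=; rewrite gE.
exact: (congr1 (fun h : {linear E -> E} => h (f x)) s'K).
Qed.

Hypotheses (I_inj : injective_module I) (I_cogen : cogenerator I).
Hypothesis A_refl : reflexive_algebra I A.

(** A retraction [g] of [cogen_map] dualises to a section of the map from tuples to functionals;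
    [w i] is the coordinate [i] of that section. *)
Lemma injective_dual_basis M n (phi : 'I_n -> {linear restr M -> I}) :
  cogenerated_by phi -> injective_module M ->
  exists w, @dual_basis A^c (DL I A M) n phi w.
Proof.
move=> phi_cogen M_inj.
have [g gE] := M_inj _ _ _ idfun (cogen_map_inj phi_cogen).
have [s [_ Ks]] := linear_inverse (@sigmaR_inj _ _ A I_cogen (right_free A n))
  (sigmaR_surj (op_refl I_inj I_cogen A_refl (right_free_fg A n))).
have w_lin i : linear (fun psi : DL I A M => s (dualL_map g psi) i : A^c^o).
  by move=> a f f'; rewrite !linearP.
exists (fun i => mk_linear (w_lin i)) => psi.
rewrite -(sigmaR_cogen_map phi) Ks; apply: linear_ext => x.
by congr ((psi : {linear _ -> _}) _); rewrite [RHS]gE.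
Qed.

Lemma inj_dual_dual_basis E : inj I E ->
  exists n e u, @dual_basis A^c (DL I A E) n e u.
Proof.
move=> E_inj; have [n [phi phi_cogen]] := inj_finitely_cogenerated E_inj.
have [w wE] := injective_dual_basis phi_cogen (inj_injective I_inj E_inj).
by exists n, phi, w.
Qed.

(** The projective is the A-dual of [DL I A M]: applying [nu] to it gives the double dual of [M]
    over [R], by biduality over [A], and this is [M] by reflexivity. *)
Lemma artinian_injective_inj M : R_artinian M -> injective_module M -> inj I M.
Proof.
move=> /(artinian_finitely_cogenerated I_cogen)[n [phi phi_cogen]] M_inj.
have [w phiw] := injective_dual_basis phi_cogen M_inj.
exists (HomR A (DL I A M)); split.
  by apply/dual_basisP; do 3!eexists; apply: homR_dual_basis phiw.
have [ev_inj ev_surj] := homR_eval_bij phiw.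
have [Dev_inj Dev_surj] := cofunctor_bij (DR I A) ev_inj ev_surj.
have M_refl := finitely_cogenerated_refl I_inj I_cogen phi_cogen A_refl.
(* [t] is [sigma] followed by the inverse of the dual of [homR_eval]. *)
have [t tE] := lift_through_inj (g := @sigma R I A M : {linear _ -> _}) Dev_inj
  (fun x => Dev_surj (sigma I x)).
exists t; apply: bij_is_iso => [x y xy|F].
  by apply: (sigma_inj I_cogen); rewrite -!tE xy.
have [x xE] := sigma_surj M_refl (dualR_map (homR_eval (DL I A M)) F).
by exists x; apply: Dev_inj; rewrite tE.
Qed.

End Injectives.

(** * The two duality statements *)

Section Dualities.
Variables (R : comPzRingType) (I : lmodType R) (A : algebra R).
Implicit Types (M : lmodType A) (N : lmodType A^c).

Local Notation op_restr := (@restr R (op_algebra A)).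

Lemma nu_inj (P : Mod A) : proj P -> inj I (nu I A P).
Proof.
move=> P_proj; exists P; split=> //.
by exists (idm _); exists (idm _); rewrite cmp1m.
Qed.

(** Evaluations at the generators [e i] cogenerate, coefficients being absorbed by the action of [A]
    on functionals. *)
Lemma dualR_finitely_cogenerated N :
  @finitely_generated A^c N -> finitely_cogenerated I (DR I A N).
Proof.
move=> [n [e e_gen]].
have ev_lin i : linear (fun F : restr (DR I A N) =>
    (F : {linear op_restr N -> I}) (e i)).
  by move=> r F G; rewrite (restr_dualR_linear r F G).
exists n, (fun i => mk_linear (ev_lin i)) => F F0.
apply: linear_ext => x; have [a ->] := e_gen x.
rewrite linear_sum big1 // => i _; exact: (F0 i (a i)).
Qed.

Hypotheses (I_inj : injective_module I) (I_cogen : cogenerator I).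
Hypotheses (A_noeth : noetherian_algebra A) (A_refl : reflexive_algebra I A).

Lemma nu_minus_proj (E : Mod A) : inj I E -> proj (nu_minus I A E).
Proof.
move=> E_inj; apply/dual_basisP.
have [n [e [u eu]]] := inj_dual_dual_basis I_inj I_cogen A_refl E_inj.
by do 3!eexists; apply: homR_dual_basis eu.
Qed.

Lemma mod_plus_noetherian M : mod_plus M <-> R_noetherian M.
Proof.
split; last exact: noetherian_finitely_generated.
exact: (serre_finitely_generated (noetherian_serre R) A_noeth).
Qed.

Lemma mod_minus_artinian M : mod_minus I M <-> R_artinian M.
Proof.
split=> [/mod_minus_finitely_cogenerated[n [phi phi_cogen]]|M_art].
  exact: (finitely_cogenerated_artinian I_inj I_cogen phi_cogen A_noeth A_refl).
exact/finitely_cogenerated_mod_minus/artinian_finitely_cogenerated.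
Qed.

Lemma mod_plus_reflexive M : mod_plus M -> reflexive_module I M.
Proof.
move=> M_fg; apply/reflexive_moduleE => //.
apply: (serre_finitely_generated (refl_serre I_inj I_cogen)) M_fg.
exact/reflexive_moduleE.
Qed.

Lemma mod_minus_reflexive M : mod_minus I M -> reflexive_module I M.
Proof.
move=> /mod_minus_finitely_cogenerated[n [phi phi_cogen]].
apply/reflexive_moduleE => //.
exact: (finitely_cogenerated_refl I_inj I_cogen phi_cogen A_refl).
Qed.

Lemma sigma_bij M : reflexive_module I M ->
  injective (@sigma R I A M) /\ forall F, exists x : M, sigma I x = F.
Proof.
move=> M_refl; split; first exact: sigma_inj.
exact/sigma_surj/reflexive_moduleE.
Qed.

Lemma sigmaR_bij N : @finitely_generated A^c N ->
  injective (sigmaR I N) /\ forall F, exists x, sigmaR I N x = F.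
Proof.
by move=> N_fg; split; [exact: sigmaR_inj | exact/sigmaR_surj/op_refl].
Qed.

Lemma dualL_mod_plus M : mod_minus I M -> @mod_plus R (op_algebra A) (DL I A M).
Proof.
move=> /mod_minus_finitely_cogenerated[n [phi phi_cogen]].
exact: (finitely_cogenerated_dual_fg I_inj I_cogen phi_cogen A_refl).
Qed.

Lemma dualR_mod_minus N : @mod_plus R (op_algebra A) N -> mod_minus I (DR I A N).
Proof.
move=> N_fg.
exact/finitely_cogenerated_mod_minus/dualR_finitely_cogenerated.
Qed.

Lemma homL_eval_natural (P P' : lmodType A) (f : {linear P -> P'}) x :
  homL_eval P' (f x) = homR_map (homL_map f) (homL_eval P x).
Proof. exact: linear_ext. Qed.

Lemma homR_eval_natural N N' (f : {linear N -> N'}) x :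
  homR_eval N' (f x) = homL_map (homR_map f) (homR_eval N x).
Proof. exact: linear_ext. Qed.

Lemma sigmaR_natural N N' (f : {linear N -> N'}) x :
  sigmaR I N' (f x) = dualL_map (dualR_map f) (sigmaR I N x).
Proof. exact: linear_ext. Qed.

Lemma sigma_natural M M' (f : {linear M -> M'}) x :
  sigma I (f x) = dualR_map (dualL_map f) (sigma I x).
Proof. exact: linear_ext. Qed.

Lemma nu_quasi_inverses :
  quasi_inverses (restrict (F := nu I A) nu_inj)
    (restrict (F := nu_minus I A) nu_minus_proj).
Proof.
split.
(* Both [nu_minus (nu P)] and [P] are compared with the A-bidual of [P], the former by removing the
   inner R-bidual of [HomL A P]. *)
- pose H (P : full (C := Mod A) (@proj R A)) : lmodType A :=
    HomR A (HomL A (sval P)).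
  apply: (@natural_iso_cospan _ A _ (cmpfunctor (restrict nu_minus_proj)
      (restrict nu_inj)) (idfunctor _) H
    (fun P P' f => fmap (cmpcofunctor (HomR A) (HomL A)) f)
    (fun P => cfmap (HomR A) (sigmaR I (HomL A (sval P))))
    (fun P => homL_eval (sval P))).
  + move=> [P /= /dual_basisP[n [e [u eu]]]].
    have [|s_inj s_surj] := @sigmaR_bij (HomL A P).
      exact: dual_basis_finitely_generated (homL_dual_basis eu).
    exact: (cofunctor_bij (HomR A) s_inj s_surj).
  + by move=> [P /= /dual_basisP[n [e [u eu]]]]; apply: homL_eval_bij eu.
  + move=> P P' f x; apply: linear_ext => v /=.
    by rewrite /homR_map /= -sigmaR_natural.
  + by move=> P P' f x; apply: homL_eval_natural.
(* Here the common term is the R-bidual of [E], reached from [nu (nu_minus E)] by removing the inner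
   A-bidual of [DL I A E]. *)
- pose H (E : full (C := Mod A) (@inj R I A)) : lmodType A :=
    DR I A (DL I A (sval E)).
  apply: (@natural_iso_cospan _ A _ (cmpfunctor (restrict nu_inj)
      (restrict nu_minus_proj)) (idfunctor _) H
    (fun E E' f => fmap (cmpcofunctor (DR I A) (DL I A)) f)
    (fun E => cfmap (DR I A) (homR_eval (DL I A (sval E))))
    (fun E => @sigma R I A (sval E))).
  + move=> [E /= E_inj].
    have [n [e [u eu]]] := inj_dual_dual_basis I_inj I_cogen A_refl E_inj.
    have [ev_inj ev_surj] := homR_eval_bij eu.
    exact: (cofunctor_bij (DR I A) ev_inj ev_surj).
  + move=> [E /= E_inj]; apply/sigma_bij/mod_minus_reflexive.
    exact/finitely_cogenerated_mod_minus/inj_finitely_cogenerated.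
  + move=> E E' f x; apply: linear_ext => v /=.
    by rewrite /dualR_map /= /restr_map -homR_eval_natural.
  + by move=> E E' f x; apply: sigma_natural.
Qed.

Definition dualL_mod :
    cofunctor (full (C := Mod A) (@mod_minus R I A))
      (full (C := Mod (op_algebra A)) (@mod_plus R (op_algebra A))) :=
  @corestrict (Mod A) (Mod (op_algebra A)) (DL I A) _ _ dualL_mod_plus.

Definition dualR_mod :
    cofunctor (full (C := Mod (op_algebra A)) (@mod_plus R (op_algebra A)))
      (full (C := Mod A) (@mod_minus R I A)) :=
  @corestrict (Mod (op_algebra A)) (Mod A) (DR I A) _ _ dualR_mod_minus.

Lemma dualR_is_duality : is_duality dualR_mod.
Proof.
exists dualL_mod; split.
- pose C := full (C := Mod (op_algebra A)) (@mod_plus R (op_algebra A)).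
  pose H (N : C) : lmodType A^c := DL I A (DR I A (sval N)).
  pose Hmap (N N' : C) (f : Defs.hom N N') : {linear H N -> H N'} :=
    fmap (cmpcofunctor (DL I A) (DR I A)) f.
  (* The composite functor is already the double dual, so one leg of the cospan is the identity. *)
  pose a (N : C) : {linear carrier (cmpcofunctor dualL_mod dualR_mod N) -> H N} :=
    idfun.
  pose b (N : C) : {linear carrier (idfunctor C N) -> H N} := sigmaR I (sval N).
  apply: (natural_iso_cospan (Hmap := Hmap) (a := a) (b := b)).
  + by move=> N; split=> [x y //|y]; exists y.
  + by move=> [N N_fg]; apply: sigmaR_bij.
  + by [].
  + by move=> N N' f x; apply: sigmaR_natural.
- pose C := full (C := Mod A) (@mod_minus R I A).
  pose H (M : C) : lmodType A := DR I A (DL I A (sval M)).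
  pose Hmap (M M' : C) (f : Defs.hom M M') : {linear H M -> H M'} :=
    fmap (cmpcofunctor (DR I A) (DL I A)) f.
  pose a (M : C) : {linear carrier (cmpcofunctor dualR_mod dualL_mod M) -> H M} :=
    idfun.
  pose b (M : C) : {linear carrier (idfunctor C M) -> H M} := @sigma R I A (sval M).
  apply: (natural_iso_cospan (Hmap := Hmap) (a := a) (b := b)).
  + by move=> M; split=> [x y //|y]; exists y.
  + by move=> [M M_minus]; apply/sigma_bij/mod_minus_reflexive.
  + by [].
  + by move=> M M' f x; apply: sigma_natural.
Qed.

End Dualities.

Theorem theorem1p4 (R : comPzRingType) (I : lmodType R) (A : algebra R)
    (I_min : minimal_injective_cogenerator I)
    (A_refl : reflexive_algebra I A)
    (A_noeth : noetherian_algebra A) :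
  ((exists (nu_inj : forall P : Mod A, proj P -> inj I (nu I A P))
           (nu_minus_proj : forall E : Mod A, inj I E -> proj (nu_minus I A E)),
      quasi_inverses (restrict (F := nu I A) nu_inj)
        (restrict (F := nu_minus I A) nu_minus_proj)) /\
   (forall M : lmodType A, proj M <-> R_noetherian M /\ projective M) /\
   (forall M : lmodType A, inj I M <-> R_artinian M /\ injective_module M))
  /\
  ((exists D_mod : forall M : Mod (op_algebra A),
        mod_plus M -> mod_minus I (DR I A M),
      is_duality (corestrict (F := DR I A) D_mod)) /\
   abelian_subcategory (C := Mod A) (@mod_plus R A) (@reflexive_module R I A) /\
   abelian_subcategory (C := Mod A) (@mod_minus R I A) (@reflexive_module R I A) /\
   (forall M : lmodType A, mod_plus M <-> R_noetherian M) /\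
   (forall M : lmodType A, mod_minus I M <-> R_artinian M)).
Proof.
have [I_inj I_cogen _] := I_min.
have noeth_serre := serre_restr A (noetherian_serre R).
have art_serre := serre_restr A (artinian_serre R).
(* Equality of predicates, rather than equivalence, lets the closure properties known for chain
   conditions be rewritten into [mod_plus] and [mod_minus]. *)
have plusE : @mod_plus R A = @R_noetherian R A.
  by apply: funext => M; apply/propext/mod_plus_noetherian.
have minusE : @mod_minus R I A = @R_artinian R A.
  by apply: funext => M; apply/propext/mod_minus_artinian.
have reflE : @reflexive_module R I A = fun M => Rreflexive I (restr M).
  by apply: funext => M; apply/propext/reflexive_moduleE.
have r_serre : serre (@reflexive_module R I A).
  by rewrite reflE; apply/serre_restr/refl_serre.
(* An object of [mod_minus], required for the zero object: the dual of the right regular module,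
   which is generated by 1. *)
have DA_minus : mod_minus I (DR I A A^c^o).
  by apply: dualR_mod_minus; exists 1%N, (fun=> 1) => x; exists (fun=> x);
    rewrite [LHS](regular_dual_basis (K := A^c) x) !big_ord1.
split; split.
- exists (@nu_inj R I A), (nu_minus_proj I_inj I_cogen A_refl).
  exact: nu_quasi_inverses.
- split=> M; split.
  + by move=> [M_fg M_proj]; split=> //; apply/mod_plus_noetherian.
  + by move=> [/mod_plus_noetherian M_fg M_proj]; split=> //; apply: M_fg.
  + move=> M_inj; split; last exact: inj_injective M_inj.
    apply/(mod_minus_artinian I_inj I_cogen A_noeth A_refl).
    exact/finitely_cogenerated_mod_minus/inj_finitely_cogenerated.
  + by move=> [M_art M_inj]; apply: artinian_injective_inj.
- by exists (@dualR_mod_minus R I A); apply: dualR_is_duality.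
- split; [|split; [|split]].
  + apply: serre_abelian_subcategory => //; last exact: mod_plus_reflexive.
      by exists (A^o : lmodType A); rewrite plusE.
    by rewrite plusE.
  + apply: serre_abelian_subcategory => //; last exact: mod_minus_reflexive.
      by exists (DR I A A^c^o).
    by rewrite minusE.
  + exact: mod_plus_noetherian.
  + exact: mod_minus_artinian.
Qed.
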